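(* Let $P(\lambda) := \sum_{j=0}^m \lambda^j A_j$ with $m\ge 1$, $A_j \in \mathbb{C}^{n\times n}$ and $\operatorname{rank}(A_m)=n$, let $\mu\in\mathbb{C}$, and let $r$ be a positive integer. For $\Gamma=(\gamma_{ik})_{1\le k<i\le r}\in\mathbb{C}^{r(r-1)/2}$ let $\mathcal{Q}(\mu,\Gamma,P)\in\mathbb{C}^{nr\times nr}$ be the block lower triangular matrix whose $n\times n$ submatrix at rows $1+(i-1)n,\dots,in$ and columns $1+(\ell-1)n,\dots,\ell n$ is $$\begin{cases}\displaystyle\sum_{(s_0,s_1,\dots,s_k)}\gamma_{s_1s_0}\gamma_{s_2s_1}\cdots\gamma_{s_ks_{k-1}}\,\frac{P^{(k)}(\mu)}{k!} & i>\ell,\\ P(\mu) & i=\ell,\\ 0 & i<\ell,\end{cases}$$ where the sum is over all (strictly) increasing sequences of positive integers $(s_0,\dots,s_k)$ (of any length) with $s_0=\ell$ and $s_k=i$. Let $\Gamma_\ast\in\mathbb{C}^{r(r-1)/2}$ be a point attaining $\sup_{\Gamma\in\mathbb{C}^{r(r-1)/2}}\sigma_{-r}(\mathcal{Q}(\mu,\Gamma,P))$ (if $r>n$, it is assumed that this supremum is attained), and suppose that the multiplicity assumption and the linear independence assumption hold at $\Gamma_\ast$. Then $$\mathbb{M}(\mu) = \sup_{\Gamma\in\mathbb{C}^{r(r-1)/2}} \sigma_{-r}\left(\mathcal{Q}(\mu,\Gamma,P)\right).$$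
   Context: The distance $\mathbb{M}(\mu)$ (depending on $P$ and $r$) is $$\mathbb{M}(\mu) := \inf\{\|\Delta\|_2 : \Delta\in\mathbb{C}^{n\times n},\ P(\lambda)+\Delta \text{ has } \mu \text{ as an eigenvalue of algebraic multiplicity} \ge r\},$$ where the algebraic multiplicity of $\mu$ as an eigenvalue of $P(\lambda)+\Delta$ is its multiplicity as a root of $\det(P(\lambda)+\Delta)$. $\sigma_{-k}(\cdot)$ denotes the $k$th smallest singular value (counted with multiplicity). Multiplicity assumption at $\Gamma_\ast$: the multiplicity of the singular value $\sigma_{-r}(\mathcal{Q}(\mu,\Gamma_\ast,P))$ is one. Linear independence assumption at $\Gamma_\ast$: if $U,V\in\mathbb{C}^{nr}$ is a consistent pair of unit left and right singular vectors of $\mathcal{Q}(\mu,\Gamma_\ast,P)$ for the singular value $\sigma=\sigma_{-r}(\mathcal{Q}(\mu,\Gamma_\ast,P))$ (i.e. $\mathcal{Q}(\mu,\Gamma_\ast,P)V=\sigma U$ and $U^\ast\mathcal{Q}(\mu,\Gamma_\ast,P)=\sigma V^\ast$), and $\mathcal{V}\in\mathbb{C}^{n\times r}$ is defined by $V=\operatorname{vec}(\mathcal{V})$ (with $\operatorname{vec}$ stacking columns), then $\operatorname{rank}(\mathcal{V})=r$. *)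

(* Defs.v *)
From HB Require Import structures.
From mathcomp Require Import all_boot all_order all_algebra.
From mathcomp Require Import complex.
From mathcomp Require Import all_classical all_reals all_analysis.

Set Implicit Arguments.
Unset Strict Implicit.
Unset Printing Implicit Defensive.

Import Order.TTheory GRing.Theory Num.Theory.

Local Open Scope ring_scope.
Local Open Scope classical_set_scope.
Local Open Scope sesquilinear_scope.

Definition vnorm2 (R : realType) (n : nat) (x : 'cV[R[i]]_n) : R :=
  Num.sqrt (\sum_(i < n) complex.Re `|x i 0| ^+ 2).

Definition specnorm (R : realType) (n : nat) (D : 'M[R[i]]_n) : R :=
  sup [set vnorm2 (D *m x) | x in [set x : 'cV[R[i]]_n | vnorm2 x = 1]].

Definition eigenvals (C : numClosedFieldType) (n : nat) (A : 'M[C]_n) : seq C :=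
  sval (closed_field_poly_normal (char_poly A)).

(* The eigenvalues of A^* A are nonnegative reals, so taking the real part
   below loses nothing. *)
Definition singvals (R : realType) (n : nat) (A : 'M[R[i]]_n) : seq R :=
  sort <=%R [seq Num.sqrt (complex.Re z) | z <- eigenvals (A ^t* *m A)].

(* The k-th smallest singular value is indexed from k = 1. *)
Definition sigma_min (R : realType) (n k : nat) (A : 'M[R[i]]_n) : R :=
  nth 0 (singvals A) k.-1.

Definition matpoly (R : realType) (n m : nat) (A : 'I_m.+1 -> 'M[R[i]]_n) :
    'M[{poly R[i]}]_n :=
  \sum_(j < m.+1) 'X^j *: map_mx polyC (A j).

Definition matpoly_deriv (R : realType) (n k : nat) (P : 'M[{poly R[i]}]_n)
    (mu : R[i]) : 'M[R[i]]_n :=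
  map_mx (fun p : {poly R[i]} => (p^`(k)).[mu]) P.

Definition eig_dist (R : realType) (n : nat) (P : 'M[{poly R[i]}]_n)
    (r : nat) (mu : R[i]) : \bar R :=
  ereal_inf [set (specnorm D)%:E | D in
    [set D : 'M[R[i]]_n | (r <= mup mu (\det (P + map_mx polyC D)))%N]].

(* A point (gamma_ik), k < i, of C^(r(r-1)/2) is encoded as the strictly lower
   triangular r x r matrix with these entries. *)
Definition strict_lower (R : realType) (r : nat) : set 'M[R[i]]_r :=
  [set G | forall i k : 'I_r, (i <= k)%N -> G i k = 0].

(* A sequence (s_0, ..., s_k) is a function 'I_k.+1 -> 'I_r. A strictly
   increasing one has k < r, hence the bound of the outer sum; its terms lie
   between s_0 and s_k, hence in 'I_r. *)
Definition Qblock (R : realType) (n r : nat) (mu : R[i]) (G : 'M[R[i]]_r)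
    (P : 'M[{poly R[i]}]_n) (i l : 'I_r) : 'M[R[i]]_n :=
  if (l < i)%N then
    \sum_(k < r)
      \sum_(s : {ffun 'I_k.+1 -> 'I_r} |
            [&& [forall a : 'I_k.+1, forall b : 'I_k.+1, (a < b)%N ==> (s a < s b)%N],
                s ord0 == l & s ord_max == i])
        (\prod_(j < k) G (s (lift ord0 j)) (s (widen_ord (leqnSn k) j)))
          *: (k`!%:R^-1 *: matpoly_deriv k P mu)
  else if i == l then matpoly_deriv 0 P mu
  else 0.

Definition Qmx (R : realType) (n r : nat) (mu : R[i]) (G : 'M[R[i]]_r)
    (P : 'M[{poly R[i]}]_n) : 'M[R[i]]_(\sum_(i < r) n) :=
  \mxblock_(i < r, l < r) Qblock mu G P i l.

Definition vec (R : realType) (n r : nat) (W : 'M[R[i]]_(n, r)) :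
    'cV[R[i]]_(\sum_(i < r) n) :=
  \mxcol_(i < r) col i W.

Definition multiplicity_assumption (R : realType) (n r : nat) (mu : R[i])
    (P : 'M[{poly R[i]}]_n) (G : 'M[R[i]]_r) : Prop :=
  count_mem (sigma_min r (Qmx mu G P)) (singvals (Qmx mu G P)) = 1%N.

Definition consistent_pair (R : realType) (N : nat) (A : 'M[R[i]]_N) (s : R)
    (U V : 'cV[R[i]]_N) : Prop :=
  [/\ vnorm2 U = 1, vnorm2 V = 1, A *m V = (s%:C)%C *: U
    & U ^t* *m A = (s%:C)%C *: V ^t*].

Definition linear_independence_assumption (R : realType) (n r : nat)
    (mu : R[i]) (P : 'M[{poly R[i]}]_n) (G : 'M[R[i]]_r) : Prop :=
  forall (U V : 'cV[R[i]]_(\sum_(i < r) n)) (W : 'M[R[i]]_(n, r)),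
    consistent_pair (Qmx mu G P) (sigma_min r (Qmx mu G P)) U V ->
    V = vec W -> \rank W = r.

(* Main.v *)
Require Import Defs.
From HB Require Import structures.
From mathcomp Require Import all_boot all_order all_algebra.
From mathcomp Require Import complex.
From mathcomp Require Import all_classical all_reals all_analysis.
From mathcomp Require Import zify ring lra.

(** Write N for the strictly upper triangular transpose of Gamma and C = mu + N.
    Identifying C^(nr) with n x r matrices X, the matrix Q(mu, Gamma, P) is the
    map X |-> P_C(X) := sum_k P^(k)(mu)/k! X N^k, which is multiplicative in P.

    Lower bound: if (lambda - mu)^r divides det (P + Delta), then the kernel of
    (P + Delta)_C has dimension at least r for every Gamma.  This follows by
    splitting off one elementary factor of determinant lambda - mu and passing
    from a row space W stable under N to W N.  On that kernel Q acts as
    X |-> - Delta X, so sigma_{-r}(Q) <= ||Delta||.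

    Upper bound: conjugating Gamma_* by 1 + t x with x triangular turns Q into
    Y (1 + t x) |-> Q(Y) (1 + t x); maximality of the simple singular value
    sigma along these curves forces U^* U = V^* V for the matrices U, V of the
    singular pair.  As V has full column rank, Delta = - sigma U (V^* V)^-1 V^*
    has norm at most sigma, and (P + Delta)_C(V) = 0 makes (lambda - mu)^r, the
    characteristic polynomial of C, a divisor of det (P + Delta). *)

Set Implicit Arguments.
Unset Strict Implicit.
Unset Printing Implicit Defensive.

Import Order.TTheory GRing.Theory Num.Theory.

Local Open Scope ring_scope.
Local Open Scope classical_set_scope.
Local Open Scope sesquilinear_scope.

(** * Polynomial matrices acting on rectangular matrices *)

(** Sylvester's identity: both sides come from factoring in two ways the block matrix with rows
    [1, -A] and [B, 1]. *)
Lemma det_1D_mulmx (R : comNzRingType) n m (A : 'M[R]_(n, m)) (B : 'M[R]_(m, n)) :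
  \det (1%:M + A *m B) = \det (1%:M + B *m A).
Proof.
have -> : \det (1%:M + A *m B)
    = \det (block_mx (1%:M + A *m B) (- A) 0 1%:M *m block_mx 1%:M 0 B 1%:M).
  by rewrite det_mulmx det_ublock det_lblock !det1 !mulr1.
have -> : \det (1%:M + B *m A)
    = \det (block_mx 1%:M 0 B 1%:M *m block_mx 1%:M (- A) 0 (1%:M + B *m A)).
  by rewrite det_mulmx det_ublock det_lblock !det1 !mul1r.
rewrite !mulmx_block !(mulmx1, mul1mx, mulmx0, mul0mx, addr0, add0r, mulmxN, mulNmx).
by rewrite addrK addrCA addNr addr0.
Qed.

(** For [P = sum_k lambda^k P_k] this is [X |-> sum_k P_k X C^k], written by rows: the indeterminate
    acts on each row of [X] through [C]. *)
Definition mxact (F : comNzRingType) n r (C : 'M[F]_r.+1) (P : 'M[{poly F}]_n)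
    (X : 'M[F]_(n, r.+1)) : 'M[F]_(n, r.+1) :=
  \matrix_i \sum_j row j X *m horner_mx C (P i j).

Section MatrixAction.
Variables (F : comNzRingType) (n r : nat) (C : 'M[F]_r.+1).
Implicit Types (P : 'M[{poly F}]_n) (X Y : 'M[F]_(n, r.+1)).

(** The factors reach the rows of [X] in reversed order, which is harmless because polynomials in
    [C] commute. *)
Lemma mxactM P E X : mxact C (P *m E) X = mxact C P (mxact C E X).
Proof.
apply/row_matrixP => i; rewrite !rowK.
under eq_bigr do rewrite mxE rmorph_sum mulmx_sumr.
under [RHS]eq_bigr do rewrite rowK mulmx_suml.
rewrite exchange_big; apply: eq_bigr => j _; apply: eq_bigr => k _ /=.
by rewrite mulrC rmorphM -mulmxA.
Qed.

Lemma mxactDl P E X : mxact C (P + E) X = mxact C P X + mxact C E X.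
Proof.
apply/row_matrixP => i; rewrite linearD /= !rowK -big_split; apply: eq_bigr => j _.
by rewrite mxE rmorphD mulmxDr.
Qed.

Lemma mxact_is_linear P : linear (mxact C P).
Proof.
move=> a X Y; apply/row_matrixP => i; rewrite linearP /= !rowK scaler_sumr -big_split.
by apply: eq_bigr => j _; rewrite linearP /= mulmxDl scalemxAl.
Qed.

HB.instance Definition mxact_linear P :=
  GRing.isLinear.Build F _ _ _ (mxact C P) (mxact_is_linear P).

Lemma mxact_scale_const p (D : 'M[F]_n) X :
  mxact C (p *: map_mx polyC D) X = D *m X *m horner_mx C p.
Proof.
apply/row_matrixP => i; rewrite rowK row_mul row_mul (mulmx_sum_row (row i D)) mulmx_suml.
apply: eq_bigr => j _.
have -> : (p *: map_mx polyC D) i j = D i j *: p.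
  by rewrite !mxE mulrC mul_polyC.
rewrite [horner_mx _ _]linearZ /= [row i D 0 j]mxE.
by rewrite -scalemxAr scalemxAl.
Qed.

Lemma mxact_const (D : 'M[F]_n) X : mxact C (map_mx polyC D) X = D *m X.
Proof. by rewrite -[map_mx _ _]scale1r mxact_scale_const rmorph1 mulmx1. Qed.

Lemma mxact1 X : mxact C 1%:M X = X.
Proof. by rewrite -(map_mx1 (polyC : {rmorphism F -> {poly F}})) mxact_const mul1mx. Qed.

End MatrixAction.

(** * Kernel dimension from a power of a linear factor in the determinant *)

Section Kernel.
Variable F : fieldType.

Lemma left_inverse_cV n (u : 'cV[F]_n) : u != 0 -> exists w : 'rV_n, w *m u = 1%:M.
Proof.
move=> /eqP u0; have [i ui|ui] := pickP (fun i => u i 0 != 0); last first.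
  by case: u0; apply/colP => i; rewrite mxE; apply/eqP; have := ui i; case: eqP.
exists ((u i 0)^-1 *: delta_mx 0 i); apply/matrixP => j k; rewrite !ord1.
by rewrite -scalemxAl -rowE !mxE mulVf.
Qed.

(* A root [mu] of [\det P] splits off a factor with determinant ['X - mu]: if
   [u] spans a line in the kernel of [P(mu)] and [w *m u = 1], the factor
   multiplies [u] by ['X - mu] and fixes [ker w]. *)
Lemma det_root_factor n (P : 'M[{poly F}]_n) mu (t := 'X - mu%:P) :
  root (\det P) mu ->
  exists (u : 'cV[F]_n) (w : 'rV[F]_n) (P' : 'M[{poly F}]_n),
    [/\ w *m u = 1%:M,
        P = P' *m (1%:M + ((t - 1) *: map_mx polyC (u *m w)))
      & \det P = \det P' * t].
Proof.
move=> muP.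
have [v v0 vP] : exists2 v : 'rV_n, v != 0 & v *m (map_mx (horner_eval mu) P)^T = 0.
  by apply/det0P; rewrite det_tr det_map_mx.
set u := v^T; have Pu0 : map_mx (horner_eval mu) P *m u = 0.
  by rewrite -[LHS]trmxK trmx_mul trmxK vP trmx0.
have [w wu] : exists w : 'rV_n, w *m u = 1%:M.
  by apply: left_inverse_cV; rewrite /u trmx_eq0.
pose U : 'cV[{poly F}]_n := map_mx polyC u; pose w' : 'rV[{poly F}]_n := map_mx polyC w.
have wU : w' *m U = 1%:M by rewrite -map_mxM wu map_mx1.
(* Division by [t] is exact because the entries of [P *m U] vanish at [mu]. *)
pose q : 'cV_n := map_mx (fun p => p %/ t) (P *m U).
have PU : P *m U = t *: q.
  apply/colP => i; rewrite [RHS]mxE [q i 0]mxE mulrC divpK //.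
  rewrite dvdp_XsubCl; apply/rootP; move/colP/(_ i): Pu0; rewrite !mxE => <-.
  by rewrite horner_sum; apply: eq_bigr => j _; rewrite !mxE hornerM hornerC.
(* This [P'] sends [U] to [q] and agrees with [P] on the kernel of [w']. *)
exists u, w, (P + (q - P *m U) *m w').
have uwE : map_mx polyC (u *m w) = U *m w' by rewrite map_mxM.
have PE : P = (P + (q - P *m U) *m w') *m (1%:M + ((t - 1) *: map_mx polyC (u *m w))).
  set X := P + _; have XU : X *m U = q.
    by rewrite mulmxDl -mulmxA wU mulmx1 addrC subrK.
  rewrite uwE mulmxDr mulmx1 -scalemxAr mulmxA XU /X mulmxBl scalerBl scale1r.
  by rewrite scalemxAl -PU -[_ *m w' - q *m w']opprB addrK.
split=> //; rewrite {1}PE det_mulmx; congr (_ * _).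
rewrite uwE scalemxAl det_1D_mulmx -scalemxAr wU det_mx11 !mxE /=.
by rewrite mulr1 addrC subrK.
Qed.

(** If the rank did not drop, [W] and [W *m N] would span the same row space, so [W] would lie in
    [W *m N ^+ j] for every [j]. *)
Lemma mxrank_mul_nilpotent k n (W : 'M[F]_(k, n.+1)) (N : 'M[F]_n.+1) q :
  N ^+ q = 0 -> W != 0 -> stablemx W N -> (\rank (W *m N) < \rank W)%N.
Proof.
move=> Nq W0 WN; rewrite ltnNge; apply/negP => le_rk.
have WleWN : (W <= W *m N)%MS by rewrite -(geq_leqif (mxrank_leqif_sup WN)).
have WX j : (W <= W *m N ^+ j)%MS.
  elim: j => [|j IH]; first by rewrite mulmx1.
  by rewrite exprS; rewrite mulmxA (submx_trans IH) // submxMr.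
by have := WX q; rewrite Nq mulmx0 => /submx0null W00; case/eqP: W0.
Qed.

(** Induction on the rank of [W]. With [P = P' *m E] from [det_root_factor], the induction
    hypothesis for [P'] and [W *m N] gives [S']. Its preimage under the action [f] of [E], cut down
    to rows in [W], maps onto [S'] and contains a part of [ker f] as large as [W :&: kermx N];
    rank-nullity for [N] on [W] adds the two counts. *)
Lemma mxact_kernel n r (C : 'M[F]_r.+1) mu q (P : 'M[{poly F}]_n) k
    (W : 'M[F]_(k, r.+1)) :
  (C - mu%:M) ^+ q = 0 -> stablemx W (C - mu%:M) ->
  ('X - mu%:P) ^+ \rank W %| \det P ->
  exists S : {vspace 'M[F]_(n, r.+1)}, (\rank W <= \dim S)%N /\
    forall X, X \in S -> (X <= W)%MS /\ mxact C P X = 0.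
Proof.
set N := C - _; move=> Nq; have [d] := ubnP (\rank W).
elim: d => // d IH in k W P * => ltd WN dvdP.
have [->|W0] := eqVneq W 0.
  exists 0%VS; rewrite mxrank0; split=> // X; rewrite memv0 => /eqP->.
  by rewrite sub0mx linear0.
have rkW : (0 < \rank W)%N by rewrite lt0n mxrank_eq0.
have rkWN := mxrank_mul_nilpotent Nq W0 WN.
have [] := @det_root_factor n P mu.
  by rewrite -dvdp_XsubCl (dvdp_trans _ dvdP) // -(prednK rkW) exprS dvdp_mulIl.
move=> u [w [P' []]]; set t := 'X - _ => wu PE detP.
set E := 1%:M + _ in PE.
have actE X : mxact C E X = X + u *m (w *m X) *m (N - 1%:M).
  rewrite mxactDl mxact1 mxact_scale_const mulmxA; congr (_ + _ *m _).
  by rewrite 2!rmorphB rmorph1 /= horner_mx_X horner_mx_C.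
have dvdP' : t ^+ \rank (W *m N) %| \det P'.
  apply: (@dvdp_trans _ (t ^+ (\rank W).-1)).
    by rewrite dvdp_exp2l // -ltnS prednK.
  by move: dvdP; rewrite -/t detP -{1}(prednK rkW) exprSr dvdp_mul2r // polyXsubC_eq0.
have [||S' [dimS' inS']] := IH _ (W *m N) P' _ _ dvdP'.
- by rewrite -ltnS; apply: leq_trans ltd.
- exact: submxMr.
pose f : 'Hom('M[F]_(n, r.+1), 'M[F]_(n, r.+1)) := linfun (mxact C E).
pose g : 'Hom('M[F]_(n, r.+1), 'M[F]_(n, r.+1)) := linfun (mulmxr (cokermx W)).
have fE X : f X = mxact C E X by rewrite lfunE.
have gE X : (X \in lker g) = (X <= W)%MS by rewrite memv_ker lfunE /= submxE.
pose S := (f @^-1: S' :&: lker g)%VS; exists S; split; last first.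
  move=> X; rewrite memv_cap gE -memv_preim fE => /andP[XS' ->]; split=> //.
  by rewrite PE mxactM; case: (inS' _ XS').
rewrite -(limg_ker_dim f S) -(mxrank_mul_ker W N) addnC leq_add //.
  (* Since [w *m u = 1], [f] sends [u *m a] to [u *m a *m N], which is zero for [a] in [K]. *)
  set K := (W :&: kermx N)%MS.
  pose h : 'Hom('rV[F]_(\rank K), 'M[F]_(n, r.+1)) :=
    linfun (mulmx u \o mulmxr (row_base K)).
  have hE a : h a = u *m (a *m row_base K) by rewrite lfunE.
  have : \dim (h @: fullv) = \rank K.
    rewrite limg_dim_eq ?dimvf /dim /= ?mul1n //.
    apply/eqP; rewrite -subv0; apply/subvP => a; rewrite memv_cap memvf memv_ker hE memv0.
    move=> /eqP/(congr1 (mulmx w)); rewrite mulmx0 mulmxA wu mul1mx => /eqP.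
    by rewrite mulmx_free_eq0 ?row_base_free.
  move=> <-; apply/dimvS/subvP => _ /memv_imgP[a _ ->].
  have aK : (a *m row_base K <= K)%MS by rewrite mulmx_sub // eq_row_base.
  move: aK; rewrite sub_capmx => /andP[aW /sub_kermxP aN].
  have fh0 : f (h a) = 0.
    rewrite fE actE hE [w *m _]mulmxA wu mul1mx -mulmxA mulmxBr aN mulmx1 sub0r.
    by rewrite mulmxN subrr.
  by rewrite !memv_cap gE -memv_preim memv_ker fh0 mem0v eqxx andbT hE mulmx_sub.
apply: (leq_trans dimS'); apply/dimvS/subvP => Y YS'.
have [YWN _] := inS' _ YS'.
have /submxP[c cE] : (w *m Y <= W *m N)%MS by rewrite mulmx_sub.
(* A preimage of [Y]: its component [w *m Y] along [u] is replaced by [c *m W], which [N] sends back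
   to [w *m Y]. *)
have fX : f (Y - u *m (w *m Y) + u *m (c *m W)) = Y.
  have wX : w *m (Y - u *m (w *m Y) + u *m (c *m W)) = c *m W.
    by rewrite mulmxDr mulmxBr !(mulmxA w u) wu !mul1mx subrr add0r.
  rewrite fE actE wX mulmxBr mulmx1 -[u *m _ *m N]mulmxA -[c *m W *m N]mulmxA -cE.
  by rewrite addrACA subrK subrr addr0.
apply/memv_imgP; exists (Y - u *m (w *m Y) + u *m (c *m W)); last by rewrite fX.
rewrite memv_cap gE -memv_preim fX YS' /=.
have YW : (Y <= W)%MS := submx_trans YWN WN.
by rewrite addmx_sub ?addmx_sub ?eqmx_opp ?mulmx_sub.
Qed.
End Kernel.

(** * Divisibility of the determinant by a characteristic polynomial *)

Lemma horner_mx_factor (F : comNzRingType) r (C : 'M[F]_r.+1) (p : {poly F}) :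
  exists W : 'M[{poly F}]_r.+1,
    p%:M - map_mx polyC (horner_mx C p) = W *m char_poly_mx C.
Proof.
elim/poly_ind: p => [|p c [W WE]].
  by exists 0; rewrite mul0mx (rmorph0 (horner_mx C)) map_mx0 raddf0 subrr.
(* Horner step: [X p - p(C) C = X (p - p(C)) + p(C) (X - C)]. *)
exists ('X *: W + map_mx polyC (horner_mx C p)).
rewrite (rmorphD (horner_mx C)) (rmorphM (horner_mx C)) /= horner_mx_X horner_mx_C.
rewrite mulmxDl -scalemxAl -WE.
rewrite map_mxD map_scalar_mx /= [horner_mx C p * C]/(_ *m _) map_mxM.
rewrite /char_poly_mx mulmxBr mul_mx_scalar raddfD /= opprD addrACA subrr addr0.
by rewrite scalerBr scale_scalar_mx mulrC addrA subrK.
Qed.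

(* [V] and [L] embed the companion module of [C] as a direct summand: on it [P]
   is a multiple of the characteristic matrix of [C], elsewhere [P] is kept. *)
Lemma char_poly_dvd_det (F : fieldType) n r (C : 'M[F]_r.+1) (P : 'M[{poly F}]_n)
    (V : 'M[F]_(n, r.+1)) (L : 'M[F]_(r.+1, n)) :
  L *m V = 1%:M -> mxact C P V = 0 -> char_poly C %| \det P.
Proof.
move=> LV PV0; pose V' : 'M[{poly F}]_(n, r.+1) := map_mx polyC V.
pose L' : 'M[{poly F}]_(r.+1, n) := map_mx polyC L.
have LV' : L' *m V' = 1%:M by rewrite -map_mxM LV map_mx1.
(* Modulo matrices of the form [W *m char_poly_mx C], the product [P *m V'] equals the constant
   matrix [mxact C P V], which is zero. *)
have [W PW] : exists W, P *m V' = W *m char_poly_mx C.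
  have [|W WE] := @fin_all_exists _ _ (fun ij (W : 'M[{poly F}]_r.+1) =>
    (P ij.1 ij.2)%:M - map_mx polyC (horner_mx C (P ij.1 ij.2)) = W *m char_poly_mx C).
    by move=> ij; apply: horner_mx_factor.
  exists (\matrix_i \sum_j row j V' *m W (i, j)).
  apply/row_matrixP => i; rewrite !row_mul rowK mulmx_suml.
  under [RHS]eq_bigr do rewrite -mulmxA -WE mulmxBr mul_mx_scalar /= -map_row -map_mxM.
  rewrite sumrB -(raddf_sum (map_mx polyC)) /=.
  move/row_matrixP/(_ i): PV0; rewrite rowK => ->; rewrite raddf0 map_mx0 subr0.
  by rewrite mulmx_sum_row; apply: eq_bigr => j _; rewrite mxE map_row.
(* [T] acts as [char_poly_mx C] on the image of [V'] and as the identity on the kernel of [L']. *)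
pose T := 1%:M + V' *m ((char_poly_mx C - 1%:M) *m L').
have detT : \det T = char_poly C.
  by rewrite /T det_1D_mulmx -mulmxA LV' mulmx1 addrC subrK.
have PT : P = (W *m L' + P *m (1%:M - V' *m L')) *m T.
  have L'T : L' *m T = char_poly_mx C *m L'.
    by rewrite mulmxDr mulmx1 mulmxA LV' mul1mx mulmxBl mul1mx addrC subrK.
  have compl : (1%:M - V' *m L') *m T = 1%:M - V' *m L'.
    rewrite mulmxDr mulmx1 mulmxA.
    have -> : (1%:M - V' *m L') *m V' = 0 by rewrite mulmxBl mul1mx -mulmxA LV' mulmx1 subrr.
    by rewrite mul0mx addr0.
  rewrite mulmxDl -!mulmxA L'T compl mulmxA -PW mulmxBr mulmx1 mulmxA addrC.
  by rewrite subrK.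
by rewrite PT det_mulmx detT dvdp_mull.
Qed.

(** Follows from [p(g^-1 A g) = g^-1 p(A) g]; it transports the action along the conjugation orbit
    used in [stationary_gram]. *)
Lemma mxact_conj (F : fieldType) n r (A g : 'M[F]_r.+1) (P : 'M[{poly F}]_n)
    (Y : 'M[F]_(n, r.+1)) :
  g \in unitmx ->
  mxact (invmx g *m A *m g) P (Y *m g) = mxact A P Y *m g.
Proof.
move=> gu; apply/row_matrixP => i; rewrite row_mul !rowK mulmx_suml.
apply: eq_bigr => j _; rewrite row_mul.
have giu : invmx g \is a GRing.unit by rewrite [_ \is a _]unitmx_inv.
have := horner_mx_uconj (P i j) A giu; rewrite invmxK => ->.
by rewrite !mulmxA mulmxK.
Qed.

(** * Leading coefficients of products and determinants *)

Lemma coefM_top (R : nzRingType) (p q : {poly R}) a b :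
  (size p <= a.+1)%N -> (size q <= b.+1)%N -> (p * q)`_(a + b) = p`_a * q`_b.
Proof.
move=> sp sq; have lt_a : (a < (a + b).+1)%N by rewrite ltnS leq_addr.
rewrite coefM (bigD1 (Ordinal lt_a)) //= addKn big1 ?addr0 // => j ja.
have [lt_ja|lt_aj|eq_ja] := ltngtP j a.
- by rewrite [q`__]nth_default ?mulr0 // (leq_trans sq) //; lia.
- by rewrite nth_default ?mul0r // (leq_trans sp).
- by case/eqP: ja; apply: val_inj.
Qed.

Lemma coef_prod_top (R : comNzRingType) n m (f : 'I_n -> {poly R}) :
  (forall i, (size (f i) <= m.+1)%N) ->
  (size (\prod_i f i)%R <= (n * m).+1)%N
  /\ (\prod_i f i)`_(n * m) = \prod_i (f i)`_m.
Proof.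
elim: n f => [|n IH] f sf; first by rewrite !big_ord0 size_poly1 coef1.
have [|sz cf] := IH (fun i => f (lift ord0 i)); first by move=> i; apply: sf.
rewrite !big_ord_recl mulSn coefM_top // cf; split=> //.
apply: leq_trans (size_polyMleq _ _) _; have := leq_add (sf ord0) sz.
by rewrite addSn addnS; case: (_ + _)%N.
Qed.

(** Each Leibniz term is a product of [n] entries of degree at most [m], so its coefficient of
    degree [n * m] is the product of their coefficients of degree [m]. *)
Lemma coef_det_top (R : comNzRingType) n m (M : 'M[{poly R}]_n) :
  (forall i j, (size (M i j) <= m.+1)%N) ->
  (\det M)`_(n * m) = \det (map_mx (coefp m) M).
Proof.
move=> sM; rewrite /determinant coef_sum; apply: eq_bigr => s _.
have sz i : (size (M i (perm.fun_of_perm s i)) <= m.+1)%N by [].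
case: (perm.odd_perm s); rewrite ?expr1 ?expr0 ?mulN1r ?mul1r ?coefN (coef_prod_top sz).2;
  by do ?congr (- _); apply: eq_bigr => i _; rewrite mxE.
Qed.

(** Expansion over all walks from [l] to [i], monotone or not, in the index order of [Qblock]. The
    induction splits off the last vertex. *)
Lemma mxpow_path_sum (R : comNzRingType) r (G : 'M[R]_r.+1) k (i l : 'I_r.+1) :
  (G ^+ k) i l = \sum_(s : {ffun 'I_k.+1 -> 'I_r.+1} |
                      (s ord0 == l) && (s ord_max == i))
    \prod_(j < k) G (s (lift ord0 j)) (s (widen_ord (leqnSn k) j)).
Proof.
elim: k i => [|k IH] i.
  rewrite expr0 mxE; under eq_bigr do rewrite big_ord0.
  pose cst (a : 'I_r.+1) : {ffun 'I_1 -> 'I_r.+1} := [ffun=> a].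
  rewrite (reindex cst) /=; last first.
    exists (fun s => s ord0) => [a _|s _]; first by rewrite ffunE.
    by apply/ffunP => j; rewrite ffunE (ord1 j).
  under eq_bigl do rewrite !ffunE.
  have [->|il] := eqVneq i l.
    by rewrite (big_pred1 l) // => a; rewrite andbb.
  rewrite big1 // => a /andP[/eqP-> /eqP li]; by rewrite li eqxx in il.
(* [h] appends an endpoint to a walk. *)
pose h (p : {ffun 'I_k.+1 -> 'I_r.+1} * 'I_r.+1) : {ffun 'I_k.+2 -> 'I_r.+1} :=
  [ffun j => if unlift ord_max j is Some j' then p.1 j' else p.2].
have h_lift p j : h p (lift ord_max j) = p.1 j by rewrite ffunE liftK.
have h_max p : h p ord_max = p.2 by rewrite ffunE unlift_none.
rewrite (reindex h) /=; last first.
  exists (fun s => ([ffun j => s (lift ord_max j)], s ord_max)) => [p _|s _].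
    by rewrite h_max; case: p => s b; congr (_, _); apply/ffunP => j; rewrite ffunE h_lift.
  apply/ffunP => j; rewrite ffunE /=.
  by case: unliftP => [j' ->|->] //; rewrite ffunE.
have h0 p : h p ord0 = p.1 ord0 by rewrite -h_lift; congr (h p _); apply: val_inj.
under eq_bigl do rewrite h0 h_max.
transitivity (\sum_(s : {ffun 'I_k.+1 -> 'I_r.+1} | s ord0 == l)
  (G i (s ord_max) * \prod_(j < k) G (s (lift ord0 j)) (s (widen_ord (leqnSn k) j)))).
  rewrite exprS mxE (partition_big (fun s : {ffun _ -> _} => s ord_max) xpredT) //=.
  apply: eq_bigr => a _; rewrite IH mulr_sumr.
  by apply: eq_bigr => s /andP[_ /eqP->].
pose T s b := \prod_(j < k.+1)
  G (h (s, b) (lift ord0 j)) (h (s, b) (widen_ord (leqnSn k.+1) j)).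
transitivity (\sum_(s : {ffun 'I_k.+1 -> 'I_r.+1} | s ord0 == l) \sum_(b | b == i) T s b).
  2: by rewrite pair_big_dep /=; apply: eq_bigr => -[].
apply: eq_bigr => s _; rewrite big_pred1_eq /T big_ord_recr /= mulrC.
congr (_ * _).
  apply: eq_bigr => j _; congr (G _ _); rewrite -(h_lift (s, i));
  by congr (h _ _); apply: val_inj; have := ltn_ord j; rewrite /= /bump; lia.
rewrite -[s ord_max](h_lift (s, i)) -[X in G X _ = _](h_max (s, i)).
by congr (G _ _); congr (h _ _); apply: val_inj; rewrite /= /bump; lia.
Qed.

(** * The block matrix Q as such an action *)

Lemma strict_lower_pow (R : realType) r (G : 'M[R[i]]_r.+1) k (i l : 'I_r.+1) :
  strict_lower G -> (i < l + k)%N -> (G ^+ k) i l = 0.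
Proof.
move=> Glow; elim: k i => [|k IH] i; rewrite ?addn0 => ilk.
  by rewrite expr0 mxE; case: eqVneq => // il; rewrite il ltnn in ilk.
rewrite exprS mxE big1 // => a _; have [ia|ai] := leqP i a; first by rewrite Glow ?mul0r.
by rewrite IH ?mulr0 //; lia.
Qed.

Lemma trmx_exp (R : comNzRingType) n (A : 'M[R]_n.+1) k : (A ^+ k)^T = A^T ^+ k.
Proof.
elim: k => [|k IH]; first by rewrite !expr0 trmx1.
by rewrite exprS trmx_mul IH exprSr.
Qed.

Lemma strict_lower_nilpotent (R : realType) r (G : 'M[R[i]]_r.+1) :
  strict_lower G -> G ^+ r.+1 = 0.
Proof.
move=> Glow; apply/matrixP => i l; rewrite strict_lower_pow ?mxE //.
by have := ltn_ord i; lia.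
Qed.

Lemma horner_mx_taylor (F : comNzRingType) r (N : 'M[F]_r.+1) q mu p :
  N ^+ q = 0 -> horner_mx (mu%:M + N) p = \sum_(k < q) p^`N(k).[mu] *: N ^+ k.
Proof.
move=> Nq; have cN : GRing.comm (mu%:M) N by apply/esym/comm_mx_scalar.
(* With [size p + q] terms the expansion can be cut at [q] whatever the degree of [p]. *)
have sz : (size (map_poly (@scalar_mx F r.+1) p) <= size p + q)%N.
  by rewrite (leq_trans (size_poly _ _)) ?leq_addr.
apply: etrans (nderiv_taylor_wide cN sz) _.
rewrite addnC big_split_ord /= [X in _ + X]big1 ?addr0 => [|k _]; last first.
  by rewrite exprD Nq mul0r mulr0.
apply: eq_bigr => k _.
by rewrite nderivn_map horner_map /= [_ * _]mul_scalar_mx.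
Qed.

(** Walks that are not increasing contribute nothing, so the sum over increasing sequences is an
    entry of [G ^+ k]; on and above the diagonal only [k = 0] can survive. *)
Lemma Qblock_pow (R : realType) n r (mu : R[i]) (G : 'M[R[i]]_r.+1)
    (P : 'M[{poly R[i]}]_n) (i l : 'I_r.+1) :
  strict_lower G ->
  Qblock mu G P i l = \sum_(k < r.+1) (G ^+ k) i l *: map_mx (fun p => p^`N(k).[mu]) P.
Proof.
move=> Glow.
have dE k : k`!%:R^-1 *: matpoly_deriv k P mu = map_mx (fun p => p^`N(k).[mu]) P.
  apply/matrixP => a b; rewrite !mxE nderivn_def hornerMn -[X in _ * X]mulr_natl mulKf //.
rewrite /Qblock; case: ifPn => [li|].
  apply: eq_bigr => k _; rewrite mxpow_path_sum scaler_suml.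
  rewrite [RHS](bigID (fun s : {ffun 'I_k.+1 -> 'I_r.+1} =>
    [forall a : 'I_k.+1, forall b : 'I_k.+1, (a < b)%N ==> (s a < s b)%N])) /=.
  rewrite [X in _ = _ + X]big1 ?addr0 => [|s /andP[_ ns]].
    apply: eq_big => [s|s _]; last by rewrite dE.
    by rewrite andbC -!andbA.
  (* A sequence that is not increasing fails at two consecutive places, where the factor of [G]
     vanishes. *)
  have [/existsP[j nj]|/existsPn inc] :=
    boolP [exists j : 'I_k, (s (lift ord0 j) <= s (widen_ord (leqnSn k) j))%N].
    by rewrite (bigD1 j) //= Glow // mul0r scale0r.
  case/negP: ns; apply/forallP => a; apply/forallP => b; apply/implyP.
  have step m : (m < k)%N -> (s (inord m) < s (inord m.+1))%N.
    move=> mk; have := inc (Ordinal mk); rewrite -ltnNge.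
    by congr (s _ < s _)%N; apply: val_inj; rewrite /= inordK // ltnS // ltnW.
  case: b => b /= lt_b; elim: b lt_b => // b IH lt_b; rewrite ltnS leq_eqVlt.
  have sb := step b lt_b.
  have -> : Ordinal lt_b = inord b.+1 by apply: val_inj; rewrite /= inordK.
  case/orP => [/eqP ab|ab]; first by rewrite -[a]inord_val ab.
  have lt_b' := ltnW lt_b; apply: ltn_trans (IH lt_b' ab) _.
  by have -> : Ordinal lt_b' = inord b by apply: val_inj; rewrite /= inordK.
rewrite -leqNgt => il; rewrite big_ord_recl big1 ?addr0 => [|k _]; last first.
  by rewrite strict_lower_pow ?scale0r //= /bump; lia.
rewrite -dE invr1 scale1r expr0 mxE.
by case: eqVneq => _; rewrite ?scale1r ?scale0r.
Qed.

(** Block [(i, l)] multiplies column [l] of [X], so the coefficients [(G ^+ k) i l] amount to right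
    multiplication by powers of [G^T], and these sum to the Taylor expansion at [mu]. *)
Lemma Qmx_vec (R : realType) n r (mu : R[i]) (G : 'M[R[i]]_r.+1)
    (P : 'M[{poly R[i]}]_n) (X : 'M[R[i]]_(n, r.+1)) :
  strict_lower G ->
  Qmx mu G P *m vec X = vec (mxact (mu%:M + G^T) P X).
Proof.
move=> Glow; rewrite /Qmx /vec mxblockEv mxcol_mul; apply: eq_mxcol => i.
rewrite mul_mxrow_mxcol.
under eq_bigr do rewrite Qblock_pow // mulmx_suml.
have Gq : G^T ^+ r.+1 = 0.
  by rewrite -trmx_exp strict_lower_nilpotent // trmx0.
apply/colP => a; rewrite summxE [RHS]mxE mxE summxE.
transitivity (\sum_(l < r.+1) \sum_(b < n) \sum_(k < r.+1)
   X b l * ((P a b)^`N(k).[mu] * (G ^+ k) i l)).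
  apply: eq_bigr => l _; rewrite summxE exchange_big; apply: eq_bigr => k _.
  rewrite -scalemxAl !mxE mulr_sumr; apply: eq_bigr => b _; rewrite !mxE.
  by rewrite [RHS]mulrC mulrA [_ * (G ^+ k) i l]mulrC -mulrA.
rewrite exchange_big; apply: eq_bigr => b _; rewrite !mxE; apply: eq_bigr => l _.
rewrite !mxE (horner_mx_taylor _ _ Gq) summxE mulr_sumr; apply: eq_bigr => k _.
by rewrite !mxE -trmx_exp mxE.
Qed.

Lemma vec_inj (R : realType) n r : injective (@vec R n r).
Proof.
move=> X Y XY; apply/matrixP => a i; have := congr1 (fun v => @submxcol _ _ (fun=> n) 1 v i) XY.
by rewrite /vec !mxcolK => /colP/(_ a); rewrite !mxE.
Qed.

Lemma vec_surj (R : realType) n r (x : 'cV[R[i]]_(\sum_(i < r) n)) :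
  exists X, x = vec X.
Proof.
exists (\matrix_(a, i) @submxcol _ _ (fun=> n) 1 x i a 0).
rewrite /vec -[LHS](@submxcolK _ _ (fun=> n)).
by apply: eq_mxcol => i; apply/colP => a; rewrite !mxE.
Qed.

(** * The real inner product of complex matrices *)

(** Real part of the trace inner product: complex matrices become a real Euclidean space, suited to
    variations in a real parameter. *)
HB.lock Definition rdot (R : realType) m n (X Y : 'M[R[i]]_(m, n)) : R :=
  complex.Re (\tr (X^t* *m Y)).

Section RealInnerProduct.
Variable R : realType.
Local Notation C := R[i].

Lemma ctrmxM m n p (A : 'M[C]_(m, n)) (B : 'M[C]_(n, p)) :
  (A *m B)^t* = B^t* *m A^t*.
Proof. by rewrite trmx_mul map_mxM. Qed.

Lemma ctrmxB m n (A B : 'M[C]_(m, n)) : (A - B)^t* = A^t* - B^t*.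
Proof. by rewrite !raddfB. Qed.

Lemma ctrmx_real_scale m n (a : R) (A : 'M[C]_(m, n)) :
  (a%:C%C *: A)^t* = a%:C%C *: A^t*.
Proof.
apply/matrixP => i j; rewrite !mxE rmorphM /=; congr (_ * _).
by rewrite -[LHS]/(conjc a%:C%C) conjc_real.
Qed.

Lemma rdotDr m n (X Y Z : 'M[C]_(m, n)) : rdot X (Y + Z) = rdot X Y + rdot X Z.
Proof. by rewrite rdot.unlock mulmxDr linearD raddfD. Qed.

Lemma rdotr0 m n (X : 'M[C]_(m, n)) : rdot X 0 = 0.
Proof. by rewrite rdot.unlock mulmx0 mxtrace0. Qed.

Lemma rdotZr m n (a : R) (X Y : 'M[C]_(m, n)) :
  rdot X (a%:C%C *: Y) = a * rdot X Y.
Proof.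
rewrite rdot.unlock -scalemxAr linearZ /=; case: (\tr _) => x y.
by rewrite /= mul0r subr0.
Qed.

Lemma rdotC m n (X Y : 'M[C]_(m, n)) : rdot X Y = rdot Y X.
Proof.
rewrite rdot.unlock; have -> : Y^t* *m X = (X^t* *m Y)^t* by rewrite ctrmxM trmxCK.
by rewrite trace_map_mx mxtrace_tr; case: (\tr _).
Qed.

Lemma rdotDl m n (X Y Z : 'M[C]_(m, n)) : rdot (X + Y) Z = rdot X Z + rdot Y Z.
Proof. by rewrite rdotC rdotDr !(rdotC Z). Qed.

Lemma rdotZl m n (a : R) (X Y : 'M[C]_(m, n)) :
  rdot (a%:C%C *: X) Y = a * rdot X Y.
Proof. by rewrite rdotC rdotZr rdotC. Qed.

Lemma rdot_mull m n p (A : 'M[C]_(p, m)) (X : 'M[C]_(m, n)) (Y : 'M[C]_(p, n)) :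
  rdot (A *m X) Y = rdot X (A^t* *m Y).
Proof. by rewrite rdot.unlock ctrmxM mulmxA. Qed.

Definition nsq m n (X : 'M[C]_(m, n)) := rdot X X.

Lemma nsqE m n (X : 'M[C]_(m, n)) :
  nsq X = \sum_j \sum_i complex.Re `|X i j| ^+ 2.
Proof.
rewrite /nsq rdot.unlock /mxtrace raddf_sum; apply: eq_bigr => j _.
rewrite mxE raddf_sum; apply: eq_bigr => i _; rewrite !mxE mulrC -normCK.
by rewrite normc_def -rmorphXn.
Qed.

Lemma nsq_ge0 m n (X : 'M[C]_(m, n)) : 0 <= nsq X.
Proof. by rewrite nsqE; do 2 (apply: sumr_ge0 => ? _); apply: sqr_ge0. Qed.

Lemma nsq0 m n : nsq (0 : 'M[C]_(m, n)) = 0.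
Proof. exact: rdotr0. Qed.

Lemma nsq_eq0 m n (X : 'M[C]_(m, n)) : (nsq X == 0) = (X == 0).
Proof.
apply/eqP/eqP => [|->]; last exact: nsq0.
have sq0 i j : 0 <= complex.Re `|X i j| ^+ 2 by apply: sqr_ge0.
rewrite nsqE => X0; apply/matrixP => i j; rewrite mxE.
have Xj : \sum_i complex.Re `|X i j| ^+ 2 = 0 :=
  psumr_eq0P (fun k _ => sumr_ge0 _ (fun i _ => sq0 i k)) X0 isT.
have /eqP : complex.Re `|X i j| ^+ 2 = 0 := psumr_eq0P (fun i _ => sq0 i j) Xj isT.
rewrite sqrf_eq0 normc_def /= => /eqP Xij0; apply/eqP.
by rewrite -normr_eq0 normc_def Xij0.
Qed.

Lemma nsqD m n (X Y : 'M[C]_(m, n)) : nsq (X + Y) = nsq X + 2 * rdot X Y + nsq Y.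
Proof. by rewrite /nsq rdotDl !rdotDr (rdotC Y X); ring. Qed.

Lemma nsqZ m n (a : R) (X : 'M[C]_(m, n)) : nsq (a%:C%C *: X) = a ^+ 2 * nsq X.
Proof. by rewrite /nsq rdotZr rdotZl; ring. Qed.

(** Weighted Young inequality, from [nsq (X - (a / e) Y) >= 0] with [a] equal to [1] or [-1]
    according to the sign of the inner product. *)
Lemma rdot_le m n (X Y : 'M[C]_(m, n)) (e : R) :
  0 < e -> 2 * `|rdot X Y| <= e * nsq X + e^-1 * nsq Y.
Proof.
move=> e0; have ei : e * e^-1 = 1 by rewrite divff ?gt_eqF.
have pm (a : R) : a ^+ 2 = 1 -> 2 * (a * rdot X Y) <= e * nsq X + e^-1 * nsq Y.
  move=> a2; have := nsq_ge0 (X - (a * e^-1)%:C%C *: Y).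
  rewrite -scaleNr -rmorphN nsqD nsqZ rdotZr => h.
  have := mulr_ge0 (ltW e0) h.
  have -> : e * (nsq X + 2 * (- (a / e) * rdot X Y) + (- (a / e)) ^+ 2 * nsq Y)
    = e * nsq X + (- 2 * (a * rdot X Y)) * (e * e^-1)
      + a ^+ 2 * (e * e^-1) * (e^-1 * nsq Y) by ring.
  by rewrite a2 ei; lra.
have [rd|rd] := leP 0 (rdot X Y).
  by rewrite ger0_norm //; have := pm 1; rewrite expr1n mul1r; apply.
by rewrite ltr0_norm //; have := pm (-1); rewrite sqrrN expr1n mulN1r; apply.
Qed.

Lemma nsq_mul_unitary m n (W : 'M[C]_m) (X : 'M[C]_(m, n)) :
  W \is unitarymx -> nsq (W *m X) = nsq X.
Proof.
move=> Wu; rewrite /nsq rdot_mull mulmxA.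
by rewrite -(invmx_unitary Wu) mulVmx ?mul1mx // unitarymx_unit.
Qed.

Lemma nsq_rows m n (X : 'M[C]_(m, n)) : nsq X = \sum_i nsq (row i X).
Proof.
rewrite nsqE exchange_big; apply: eq_bigr => i _; rewrite nsqE.
by apply: eq_bigr => j _; rewrite big_ord1 mxE.
Qed.

Lemma nsq_tr m n (X : 'M[C]_(m, n)) : nsq X^T = nsq X.
Proof.
rewrite !nsqE exchange_big; apply: eq_bigr => j _.
by apply: eq_bigr => i _; rewrite mxE.
Qed.

Lemma nsq_cols m n (X : 'M[C]_(m, n)) : nsq X = \sum_j nsq (col j X).
Proof. by rewrite -nsq_tr nsq_rows; apply: eq_bigr => j _; rewrite -tr_col nsq_tr. Qed.

Lemma nsq_ctr m n (X : 'M[C]_(m, n)) : nsq (X^t*) = nsq X.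
Proof.
rewrite -nsq_tr !nsqE; apply: eq_bigr => i _; apply: eq_bigr => j _.
by rewrite !mxE norm_conjC.
Qed.

Lemma vnorm2E n (x : 'cV[C]_n) : vnorm2 x = Num.sqrt (nsq x).
Proof. by rewrite /vnorm2 nsqE big_ord1. Qed.

Lemma nsq_vec n r (X : 'M[C]_(n, r)) : nsq (vec X) = nsq X.
Proof.
rewrite {1}/nsq rdot.unlock /vec; set Y := (X in X *m _).
have -> : Y = \mxrow_(i < r) (col i X)^t*.
  by rewrite /Y tr_mxcol; apply/matrixP => a b; rewrite !mxE.
rewrite mul_mxrow_mxcol [\tr _]linear_sum /= raddf_sum nsq_cols.
by apply: eq_bigr => i _; rewrite /nsq rdot.unlock.
Qed.

End RealInnerProduct.

(** * Singular values *)

Lemma count_nth_sort (R : realDomainType) (l : seq R) k (c := nth 0 (sort <=%R l) k) :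
  (k < size l)%N ->
  (count (fun x => x < c)%R l <= k)%N /\ (k + count (fun x => c < x)%R l < size l)%N.
Proof.
rewrite -(size_sort <=%R) /c => kl; rewrite -!(permP (permEl (perm_sort <=%R l))).
set l' := sort _ l in kl *.
have sl : sorted <=%R l' by apply: sort_sorted; apply: le_total.
have mono i j : (i <= j)%N -> (j < size l')%N -> nth 0 l' i <= nth 0 l' j.
  by move=> ij jl; apply: (sorted_leq_nth le_trans le_refl) => //; rewrite inE ?(leq_ltn_trans ij).
split.
  rewrite -[X in count _ X](cat_take_drop k) count_cat.
  have -> : count (fun x => x < nth 0 l' k) (drop k l') = 0%N.
    apply/eqP; rewrite eqn0Ngt -has_count; apply/hasPn => x /(nthP 0)[j].
    rewrite size_drop nth_drop => jl <-; rewrite -leNgt mono ?leq_addr //.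
    by rewrite -ltn_subRL.
  by rewrite addn0 (leq_trans (count_size _ _)) // size_take; case: ltnP.
rewrite -[X in count _ X](cat_take_drop k.+1) count_cat.
have -> : count (fun x => nth 0 l' k < x) (take k.+1 l') = 0%N.
  apply/eqP; rewrite eqn0Ngt -has_count; apply/hasPn => x /(nthP 0)[j].
  rewrite size_take => jl <-.
  have jk : (j < k.+1)%N by move: jl; case: ifP; lia.
  by rewrite nth_take // -leNgt mono.
have := count_size (fun x => nth 0 l' k < x) (drop k.+1 l').
by rewrite size_drop add0n -addSn -leq_subRL.
Qed.

(** Rank-nullity for the map reading off the coordinates in [J]. *)
Lemma exists_constrained (F : fieldType) (aT : vectType F) (S : {vspace aT}) N
    (f : {linear aT -> 'cV[F]_N}) (J : {set 'I_N}) :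
  exists S' : {vspace aT}, [/\ (S' <= S)%VS, (\dim S <= \dim S' + #|J|)%N &
    forall y, y \in S' -> forall i, i \in J -> f y i 0 = 0].
Proof.
pose g : 'Hom(aT, 'cV[F]_#|J|) := linfun (rowsub enum_val \o f).
exists (S :&: lker g)%VS; split; first exact: capvSl.
  rewrite -(limg_ker_dim g S) leq_add2l.
  by rewrite (leq_trans (dimvS (subvf _))) // dimvf /dim /= muln1.
move=> y; rewrite memv_cap memv_ker lfunE => /andP[_ /eqP/colP y0] i iJ.
by have := y0 (enum_rank_in iJ i); rewrite !mxE enum_rankK_in.
Qed.

Lemma char_poly_conj (F : fieldType) n (A B : 'M[F]_n) :
  B \in unitmx -> char_poly (invmx B *m A *m B) = char_poly A.
Proof.
move=> Bu; pose b : 'M[{poly F}]_n := map_mx polyC B.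
pose b' : 'M[{poly F}]_n := map_mx polyC (invmx B).
have bb : b' *m b = 1%:M by rewrite -map_mxM mulVmx ?map_mx1.
have -> : char_poly (invmx B *m A *m B) = \det (b' *m char_poly_mx A *m b).
  congr (\det _); rewrite /char_poly_mx mulmxBr mulmxBl !map_mxM.
  by rewrite mul_mx_scalar -scalemxAl bb scalemx1.
by rewrite !det_mulmx mulrAC -det_mulmx bb det1 mul1r.
Qed.

Section SingularValues.
Variable R : realType.
Local Notation C := R[i].

(** Spectral theorem for [A^t* *m A]. The list [eigenvals] and the diagonal entries are root lists
    of the same characteristic polynomial, so they agree up to order. *)
Lemma singvals_spectral N (A : 'M[C]_N) :
  exists (W : 'M[C]_N) (s : 'I_N -> R),
    [/\ W \is unitarymx, forall i, 0 <= s i,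
        singvals A = sort <=%R [seq s i | i <- enum 'I_N]
      & W *m (A^t* *m A) = diag_mx (\row_i ((s i) ^+ 2)%:C%C) *m W].
Proof.
set B := A^t* *m A.
have Bt : B^t* = B by rewrite ctrmxM trmxCK.
have Bn : B \is normalmx by apply/normalmxP; rewrite Bt.
have Wu := spectral_unitarymx B; have Wunit := unitarymx_unit Wu.
have BE := elimT (@orthomx_spectralP _ _ B) Bn.
set W := spectralmx B in Wu Wunit BE; set d := spectral_diag B in BE.
have WB : W *m B = diag_mx d *m W by rewrite {1}BE -mulmxA mulKVmx.
pose s i := Num.sqrt (complex.Re (d 0 i)).
(* Each diagonal entry is the squared norm of a column of [A *m W^t*]. *)
have d_ge0 i : 0 <= d 0 i.
  have -> : d 0 i = (((A *m W^t*)^t*) *m (A *m W^t*)) i i.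
    rewrite ctrmxM trmxCK mulmxA -[W *m _ *m A]mulmxA WB -mulmxA.
    by rewrite (unitarymxP Wu) mulmx1 mxE eqxx mulr1n.
  rewrite mxE; apply: sumr_ge0 => k _; rewrite !mxE mulrC; exact: mul_conjC_ge0.
have dE i : d 0 i = ((s i) ^+ 2)%:C%C.
  have := d_ge0 i; rewrite lecE /s => /andP[/eqP im re].
  rewrite sqr_sqrtr //; move: im; case: (d 0 i) => x y /= ->.
  by [].
exists W, s; split; first exact: Wu.
- by move=> i; rewrite /s sqrtr_ge0.
- rewrite /singvals -/B; apply/(perm_sortP (@le_total _ R) (@le_trans _ R) (@le_anti _ R)).
  rewrite (map_comp (fun z => Num.sqrt (complex.Re z)) (d 0)).
  apply: perm_map; apply: prod_XsubC_eq; rewrite /eigenvals.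
  case: closed_field_poly_normal => /= l.
  rewrite (monicP (char_poly_monic _)) scale1r => <-.
  rewrite BE char_poly_conj // char_poly_trig ?diag_mx_is_trig //.
  rewrite big_map big_enum; apply: eq_bigr => i _ /=.
  by rewrite mxE eqxx mulr1n.
- by rewrite WB; congr (diag_mx _ *m _); apply/rowP => i; rewrite mxE dE.
Qed.
End SingularValues.

(** * Min-max bounds for singular values *)

Section SingularValueBounds.
Variable R : realType.
Local Notation C := R[i].

Lemma vec_is_linear n r : linear (@vec R n r).
Proof.
move=> a X Y; rewrite /vec; apply/colP => k; rewrite !mxE.
by [].
Qed.

HB.instance Definition vec_linear n r :=
  GRing.isLinear.Build C 'M[C]_(n, r) _ _ (@vec R n r) (@vec_is_linear n r).

Lemma nsq_mul_diag N (s : 'I_N -> R) (z : 'cV[C]_N) :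
  rdot z (diag_mx (\row_i (s i)%:C%C) *m z) = \sum_i s i * nsq (row i z).
Proof.
rewrite rdot.unlock /mxtrace big_ord1 mxE raddf_sum; apply: eq_bigr => i _.
rewrite nsqE !big_ord1 mul_diag_mx !mxE normc_def mulrCA.
rewrite [_^* * _]mulrC -normCK normc_def -rmorphXn /=.
by rewrite mul0r subr0.
Qed.

Section Spectral.
Variables (N : nat) (A W : 'M[C]_N) (s : 'I_N -> R).
Hypothesis Wu : W \is unitarymx.
Hypothesis WA : W *m (A^t* *m A) = diag_mx (\row_i ((s i) ^+ 2)%:C%C) *m W.

Lemma nsq_spectral (x : 'cV[C]_N) :
  nsq (A *m x) = \sum_i s i ^+ 2 * nsq (row i (W *m x)).
Proof.
rewrite -nsq_mul_diag mulmxA -WA -[W *m _ *m x]mulmxA [RHS]rdot_mull.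
by rewrite -(invmx_unitary Wu) mulKmx ?unitarymx_unit // /nsq rdot_mull mulmxA.
Qed.

Lemma nsq_unitary_rows (x : 'cV[C]_N) : nsq x = \sum_i nsq (row i (W *m x)).
Proof. by rewrite -nsq_rows nsq_mul_unitary. Qed.

End Spectral.

Lemma nsq_row0 N (z : 'cV[C]_N) i : z i 0 = 0 -> nsq (row i z) = 0.
Proof.
by move=> z0; apply/eqP; rewrite nsq_eq0; apply/eqP/matrixP => a b; rewrite !mxE !ord1.
Qed.

Lemma nsq_mul_bounded N (A : 'M[C]_N) :
  exists K, 0 <= K /\ forall p (X : 'M[C]_(N, p)), nsq (A *m X) <= K * nsq X.
Proof.
have [W [s [Wu s0 _ WA]]] := singvals_spectral A.
exists (\sum_i s i ^+ 2); split=> [|p X]; first by apply: sumr_ge0 => i _; apply: sqr_ge0.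
rewrite nsq_cols (nsq_cols X) mulr_sumr ler_sum // => j _.
rewrite colE -mulmxA -colE (nsq_spectral Wu WA) (nsq_unitary_rows Wu (col j X)).
rewrite mulr_suml ler_sum // => i _; rewrite ler_wpM2l ?sqr_ge0 //.
by rewrite (bigD1 i) //= lerDl sumr_ge0 // => k _; apply: nsq_ge0.
Qed.

Lemma card_singvals N (A : 'M[C]_N) (s : 'I_N -> R) k :
  singvals A = sort <=%R [seq s i | i <- enum 'I_N] -> (0 < k <= N)%N ->
  (#|finset (fun i => s i < sigma_min k A)%R| < k)%N
  /\ (k + #|finset (fun i => sigma_min k A < s i)%R| <= N)%N.
Proof.
move=> sE /andP[k0 kN].
have [|c1 c2] := @count_nth_sort R [seq s i | i <- enum 'I_N] k.-1.
- by rewrite size_map size_enum_ord prednK.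
have mE (p : pred R) : count p [seq s i | i <- enum 'I_N] = count (preim s p) (enum 'I_N).
  exact: count_map.
move: c1 c2; rewrite -sE -/(sigma_min k A) !mE size_map size_enum_ord.
have cE (p : pred 'I_N) : #|finset p| = count p (enum 'I_N).
  rewrite cardE -size_filter {1}/enum_mem -enumT; congr size.
  by apply: eq_filter => i; rewrite /= inE.
rewrite !cE /preim /=; move=> c1 c2; split; first by rewrite -(prednK k0) ltnS.
by rewrite -(prednK k0) addSn.
Qed.

Lemma sigma_min_ge0 N (A : 'M[C]_N) k : 0 <= sigma_min k A.
Proof.
rewrite /sigma_min; have [lt|ge] := ltnP k.-1 (size (singvals A)); last by rewrite nth_default.
have := mem_nth 0 lt; rewrite mem_sort => /mapP[z _ ->]; exact: sqrtr_ge0.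
Qed.

(** At most [N - k] singular values exceed [sigma_min k A]; killing the coordinates that belong to
    them leaves [S']. *)
Lemma sigma_min_upper N (A : 'M[C]_N) k (aT : vectType C) (S : {vspace aT})
    (f : {linear aT -> 'cV[C]_N}) : (0 < k <= N)%N ->
  exists S' : {vspace aT}, [/\ (S' <= S)%VS, (\dim S + k <= \dim S' + N)%N &
    forall y, y \in S' -> nsq (A *m f y) <= sigma_min k A ^+ 2 * nsq (f y)].
Proof.
move=> kN; have [W [s [Wu s0 sE WA]]] := singvals_spectral A.
have [_ cJ] := card_singvals sE kN; set J := finset _ in cJ.
have [S' [S'S dS' fS']] := exists_constrained S (mulmx W \o f) J.
exists S'; split=> // [|y yS'].
  by rewrite (leq_trans (leq_add dS' (leqnn k))) // -addnA leq_add2l addnC.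
rewrite (nsq_spectral Wu WA) (nsq_unitary_rows Wu (f y)) mulr_sumr ler_sum // => i _.
have [lt|ge] := ltP (sigma_min k A) (s i).
  by rewrite nsq_row0 ?mulr0 //; apply: (fS' y yS'); rewrite inE.
by rewrite ler_wpM2r ?nsq_ge0 // ler_sqr ?nnegrE ?sigma_min_ge0.
Qed.

(** Fewer than [k] singular values lie below [sigma_min k A], so [S] contains a nonzero vector
    without components there, and on it [A] expands by at least [sigma_min k A]. *)
Lemma sigma_min_le N (A : 'M[C]_N) k (aT : vectType C) (S : {vspace aT})
    (f : {linear aT -> 'cV[C]_N}) (c : R) :
  (0 < k <= N)%N -> (k <= \dim S)%N -> injective f -> 0 <= c ->
  (forall y, y \in S -> nsq (A *m f y) <= c ^+ 2 * nsq (f y)) ->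
  sigma_min k A <= c.
Proof.
move=> kN kS finj c0 fS; have [W [s [Wu s0 sE WA]]] := singvals_spectral A.
have [cJ _] := card_singvals sE kN; set J := finset _ in cJ.
have [S' [S'S dS' fS']] := exists_constrained S (mulmx W \o f) J.
have S'0 : S' != 0%VS.
  by rewrite -dimv_eq0 -lt0n -(ltn_add2r #|J|) add0n (leq_trans _ dS') // (leq_trans cJ).
have yS' := memv_pick S'; set y := vpick S' in yS'.
have y0 : y != 0 by rewrite vpick0.
have fy0 : 0 < nsq (f y).
  by rewrite lt_def nsq_ge0 andbT nsq_eq0 -(linear0 f) (inj_eq finj).
have h1 := fS y (subvP S'S _ yS').
have h2 : sigma_min k A ^+ 2 * nsq (f y) <= nsq (A *m f y).
  rewrite (nsq_spectral Wu WA) (nsq_unitary_rows Wu (f y)) mulr_sumr ler_sum // => i _.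
  have [lt|ge] := ltP (s i) (sigma_min k A).
    by rewrite nsq_row0 ?mulr0 //; apply: (fS' y yS'); rewrite inE.
  by rewrite ler_wpM2r ?nsq_ge0 // ler_sqr ?nnegrE ?sigma_min_ge0.
have := le_trans h2 h1; rewrite ler_pM2r // ler_sqr ?nnegrE ?sigma_min_ge0 //.
Qed.

End SingularValueBounds.

(** * Perturbation estimates *)

Section Perturbation.
Variable R : realType.
Local Notation C := R[i].

Lemma nsq_mulr_bounded r (x : 'M[C]_r) :
  exists K, 0 <= K /\ forall n (Y : 'M[C]_(n, r)), nsq (Y *m x) <= K * nsq Y.
Proof.
have [K [K0 KP]] := nsq_mul_bounded (x^t*); exists K; split=> // n Y.
by rewrite -nsq_ctr ctrmxM -[nsq Y]nsq_ctr KP.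
Qed.

(** After the leading terms cancel, [rdot_le] with weight [e] puts a factor of order [e] on [nsq p]
    and a large one on [nsq z]. In use, [p] is the component along the singular vector and [z] the
    remainder. *)
Lemma rdot_mulr_perturb n r (x : 'M[C]_r) (K e : R) (p z : 'M[C]_(n, r)) :
  (forall Y : 'M[C]_(n, r), nsq (Y *m x) <= K * nsq Y) -> 0 < e ->
  `|2 * rdot (p + z) ((p + z) *m x) - 2 * rdot p (p *m x)|
    <= (1 + K) * (e * nsq p + (e^-1 + 1) * nsq z).
Proof.
move=> KP e0; have ei0 : 0 < e^-1 by rewrite invr_gt0.
rewrite mulmxDl rdotDl !rdotDr.
have h1 := rdot_le p (z *m x) e0; have h2 := rdot_le z (p *m x) ei0.
have h3 := rdot_le z (z *m x) (@ltr01 R).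
rewrite invrK in h2; rewrite invr1 !mul1r in h3.
have k1 := ler_wpM2l (ltW ei0) (KP z); have k2 := ler_wpM2l (ltW e0) (KP p).
have k3 := KP z.
move: h1 h2 h3; set a := rdot p (z *m x); set b := rdot z (p *m x).
set c := rdot z (z *m x) => h1 h2 h3.
have -> : 2 * (rdot p (p *m x) + a + (b + c)) - 2 * rdot p (p *m x) = 2 * (a + b + c).
  by ring.
have tri : `|2 * (a + b + c)| <= 2 * `|a| + 2 * `|b| + 2 * `|c|.
  rewrite normrM ger0_norm // -!mulrDr ler_pM2l //.
  by rewrite (le_trans (ler_normD _ _)) // lerD2r ler_normD.
apply: (le_trans tri); rewrite !mulrDl !mulrDr !mul1r; lra.
Qed.

(* Choosing [e] with [(1 + K) e = d / 2] leaves the [al]-coefficient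
   [s^2 t (d - t K)], which is positive for small [t]. *)
Lemma perturb_scalar (K L s d g : R) :
  0 <= K -> 0 <= L -> 0 < s -> 0 < d -> 0 < g ->
  exists e t : R, [/\ 0 < e, 0 < t, t ^+ 2 * K < 1 &
    forall al et : R, 0 <= al -> 0 <= et -> 0 < al + et ->
      0 < g * et
          + t * (2 * al * s ^+ 2 * d
                 - (1 + K) * (e * (s ^+ 2 * al) + (e^-1 + 1) * (L * et))
                 - s ^+ 2 * ((1 + K) * (e * al + (e^-1 + 1) * et)))
          - s ^+ 2 * (t ^+ 2 * (K * (al + et)))].
Proof.
move=> K0 L0 s0 d0 g0; have K1 : 0 < 1 + K by lra.
pose e := d / (2 * (1 + K)); have e0 : 0 < e by rewrite divr_gt0 // mulr_gt0.
have eK : (1 + K) * e = d / 2 by rewrite /e; field; rewrite gt_eqF.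
have ei0 : 0 < e^-1 by rewrite invr_gt0.
pose c := (1 + K) * (e^-1 + 1); have c0 : 0 <= c by rewrite mulr_ge0 //; lra.
have s20 : 0 < s ^+ 2 by rewrite exprn_gt0.
pose M := c * (L + s ^+ 2) + s ^+ 2 * K.
have M0 : 0 <= M by rewrite addr_ge0 // mulr_ge0 //; lra.
(* The inverse of [D] serves as [t]: the summands give [t * K < 1], [t * K < d] and [t * M < g],
   strictly because of the summand [1]. *)
pose D := 1 + K + K / d + M / g.
have Kd : 0 <= K / d by rewrite divr_ge0 // ltW.
have Mg : 0 <= M / g by rewrite divr_ge0 // ltW.
have D1 : 1 <= D by rewrite /D; lra.
have D0 : 0 < D by lra.
pose t := D^-1; have t0 : 0 < t by rewrite invr_gt0.
have tD : t * D = 1 by rewrite mulVf // gt_eqF.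
have t1 : t <= 1 by rewrite invf_le1.
have h1 : t * (1 + K + K / d + M / g) = 1 by [].
have tK : t * K < 1.
  have : 0 <= t * (K / d) by rewrite mulr_ge0 // ltW.
  have : 0 <= t * (M / g) by rewrite mulr_ge0 // ltW.
  by move: h1; rewrite !mulrDr mulr1; lra.
have tKd : t * K < d.
  have : t * (K / d) < 1.
    have : 0 <= t * K by rewrite mulr_ge0 // ltW.
    have : 0 <= t * (M / g) by rewrite mulr_ge0 // ltW.
    by move: h1; rewrite !mulrDr mulr1; lra.
  by rewrite mulrA ltr_pdivrMr // mul1r.
have tMg : t * M < g.
  have : t * (M / g) < 1.
    have : 0 <= t * K by rewrite mulr_ge0 // ltW.
    have : 0 <= t * (K / d) by rewrite mulr_ge0 // ltW.
    by move: h1; rewrite !mulrDr mulr1; lra.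
  by rewrite mulrA ltr_pdivrMr // mul1r.
exists e, t; split=> //.
  have tK0 : 0 <= t * K by rewrite mulr_ge0 // ltW.
  by rewrite expr2 -mulrA; apply: le_lt_trans tK; rewrite ler_piMl.
move=> al et al0 et0 aet.
have t2 : t ^+ 2 * (s ^+ 2 * K) <= t * (s ^+ 2 * K).
  have sK : 0 <= s ^+ 2 * K by rewrite mulr_ge0 // ltW.
  by rewrite ler_wpM2r // expr2 ler_piMr // ltW.
have -> : g * et
  + t * (2 * al * s ^+ 2 * d
         - (1 + K) * (e * (s ^+ 2 * al) + (e^-1 + 1) * (L * et))
         - s ^+ 2 * ((1 + K) * (e * al + (e^-1 + 1) * et)))
  - s ^+ 2 * (t ^+ 2 * (K * (al + et)))
  = al * (s ^+ 2 * t * (2 * d - 2 * ((1 + K) * e) - t * K))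
    + et * (g - t * (c * (L + s ^+ 2)) - t ^+ 2 * (s ^+ 2 * K)).
  by rewrite /c; ring.
have pa : 0 < s ^+ 2 * t * (2 * d - 2 * ((1 + K) * e) - t * K).
  by rewrite eK mulr_gt0 ?mulr_gt0 //; lra.
have pe : 0 < g - t * (c * (L + s ^+ 2)) - t ^+ 2 * (s ^+ 2 * K).
  by move: tMg; rewrite /M mulrDr; lra.
have [a0|a0] := eqVneq al 0.
  by rewrite a0 mul0r add0r mulr_gt0 //; lra.
have alp : 0 < al by rewrite lt_def a0.
by apply: ltr_pwDl; [apply: mulr_gt0|apply: mulr_ge0 => //; apply: ltW].
Qed.

(** A nonzero Hermitian matrix has a nonzero entry on or below the diagonal. Taking for [x] the
    conjugate transpose of that half makes the trace a sum of squared moduli. *)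
Lemma upper_tri_selector r (E : 'M[C]_r) :
  E^t* = E -> E != 0 ->
  exists x : 'M[C]_r, (forall i j : 'I_r, (j < i)%N -> x i j = 0)
    /\ 0 < complex.Re (\tr (E *m x)).
Proof.
move=> EH E0.
have [i [j [ij Eij]]] : exists i j : 'I_r, (i <= j)%N /\ E j i != 0.
  have [/existsP[i /existsP[j /andP[]]]|] :=
    boolP [exists i : 'I_r, exists j : 'I_r, (i <= j)%N && (E j i != 0)].
    by exists i, j.
  move=> /existsPn nE; case/eqP: E0; apply/matrixP => a b; rewrite mxE.
  have lowE (i j : 'I_r) : (i <= j)%N -> E j i = 0.
    by move=> ij; have /existsPn/(_ j) := nE i; rewrite ij negbK => /eqP.
  have [ba|ab] := leqP b a; first exact: lowE.
  by rewrite -EH !mxE lowE ?rmorph0 // ltnW.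
exists (\matrix_(i, j) if (i <= j)%N then (E j i)^* else 0); split.
  by move=> a b ba; rewrite mxE leqNgt ba.
have term a b : 0 <= complex.Re (E b a * (if (a <= b)%N then (E b a)^* else 0)).
  case: ifP => _; last by rewrite mulr0.
  by rewrite -normCK normc_def -rmorphXn /= sqr_ge0.
rewrite /mxtrace raddf_sum (bigD1 j) //= ltr_wpDr //.
  apply: sumr_ge0 => b _; rewrite mxE raddf_sum sumr_ge0 // => a _.
  by rewrite mxE term.
rewrite mxE raddf_sum (bigD1 i) //= ltr_wpDr //.
  by apply: sumr_ge0 => a _; rewrite mxE term.
rewrite mxE ij -normCK normc_def -rmorphXn /= exprn_gt0 //.
by rewrite -ltcR -normc_def normr_gt0.
Qed.

(** Entry [(i, k)] of [G' *m L] is solved for [G' i k] with [k] descending from the last column: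
    later columns vanish by induction, and [L k k] is nonzero. *)
Lemma strict_lower_conj r (G G' L : 'M[C]_r) :
  (forall i j : 'I_r, (i < j)%N -> L i j = 0) -> L \in unitmx ->
  strict_lower G -> G' *m L = L *m G -> strict_lower G'.
Proof.
move=> Llow Lu Glow GL i.
have Ldiag k : L k k != 0.
  have : \det L != 0 by rewrite -unitfE -unitmxE.
  rewrite det_trig; last by apply/is_trig_mxP.
  by move/prodf_neq0; apply.
have LG (k : 'I_r) : (i <= k)%N -> (L *m G) i k = 0.
  move=> ik; rewrite mxE big1 // => a _.
  have [ia|ai] := ltnP i a; first by rewrite Llow ?mul0r.
  by rewrite Glow ?mulr0 // (leq_trans ai).
move=> k; have [m] := ubnP (r - k)%N; elim: m k => // m IH k km ik.
have := LG k ik; rewrite -GL mxE (bigD1 k) //= big1 ?addr0 => [|j jk].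
  by move/eqP; rewrite mulf_eq0 (negPf (Ldiag k)) orbF => /eqP.
have [lt_jk|lt_kj|eq_jk] := ltngtP j k.
- by rewrite Llow ?mulr0.
- rewrite IH ?mul0r ?(leq_trans ik (ltnW lt_kj)) //.
  by have := ltn_ord j; lia.
- by case/eqP: jk; apply: val_inj.
Qed.

Lemma finite_gap (I : finType) (P : pred I) (f : I -> R) :
  (forall i, P i -> 0 < f i) -> exists2 g, 0 < g & forall i, P i -> g <= f i.
Proof.
(* The default [1] keeps the minimum positive when [P] holds nowhere. *)
move=> f0; exists (\big[Order.min/1]_(i | P i) f i); last first.
  by move=> i Pi; apply: bigmin_le_cond.
by elim/big_ind: _ => // [x y x0 y0]; rewrite lt_min x0.
Qed.

End Perturbation.

(** * Spectral norm and the lower bound *)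

Section SpectralNorm.
Variable R : realType.
Local Notation C := R[i].

Lemma vnorm2_sq n (x : 'cV[C]_n) : vnorm2 x ^+ 2 = nsq x.
Proof. by rewrite vnorm2E sqr_sqrtr ?nsq_ge0. Qed.

Lemma vnorm2_ge0 n (x : 'cV[C]_n) : 0 <= vnorm2 x.
Proof. exact: sqrtr_ge0. Qed.

Lemma vnorm2_le n p (x : 'cV[C]_n) (y : 'cV[C]_p) c :
  0 <= c -> nsq x <= c ^+ 2 * nsq y -> vnorm2 x <= c * vnorm2 y.
Proof.
move=> c0 h; rewrite -ler_sqr ?nnegrE ?mulr_ge0 ?vnorm2_ge0 //.
by rewrite exprMn !vnorm2_sq.
Qed.

Lemma vnorm2_eq1 n (x : 'cV[C]_n) : nsq x = 1 -> vnorm2 x = 1.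
Proof. by move=> x1; rewrite vnorm2E x1 sqrtr1. Qed.

Lemma nsq_normalize n (x : 'cV[C]_n) : x != 0 ->
  nsq (((Num.sqrt (nsq x))^-1)%:C%C *: x) = 1.
Proof.
move=> x0; rewrite nsqZ exprVn sqr_sqrtr ?nsq_ge0 // mulVf //.
by rewrite nsq_eq0.
Qed.

Lemma delta_unit n (i : 'I_n) : nsq (delta_mx i 0 : 'cV[C]_n) = 1.
Proof.
have dE j : (delta_mx i 0 : 'cV[C]_n) j ord0 = (j == i)%:R by rewrite mxE andbT.
rewrite nsqE big_ord1 (bigD1 i) // big1 ?addr0 => [|j /negPf ji].
  by rewrite dE eqxx normr1 /= expr1n addr0.
by move: ji; rewrite mxE andbT => ->; rewrite normr0 /= expr0n.
Qed.

Lemma specnorm_bound n (D : 'M[C]_n) (x : 'cV[C]_n) :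
  nsq (D *m x) <= specnorm D ^+ 2 * nsq x.
Proof.
have [->|x0] := eqVneq x 0; first by rewrite mulmx0 !nsq0 mulr0.
have [K [K0 KP]] := nsq_mul_bounded D.
have y1 := nsq_normalize x0; set c := (Num.sqrt _)^-1 in y1.
have le_sup : vnorm2 (D *m (c%:C%C *: x)) <= specnorm D.
  (* The supremum dominates its set once that set is bounded, which the crude constant [K]
     ensures. *)
  apply: ub_le_sup.
    exists (Num.sqrt K) => _ [z z1 <-]; rewrite vnorm2E ler_sqrt //.
    by rewrite (le_trans (KP _ _)) // -vnorm2_sq z1 expr1n mulr1.
  by exists (c%:C%C *: x) => //; apply: vnorm2_eq1.
have := le_sup; rewrite -(@ler_pXn2r _ 2) ?nnegrE ?vnorm2_ge0 //; last first.
  exact: le_trans (vnorm2_ge0 _) le_sup.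
have nx0 : 0 < nsq x by rewrite lt_def nsq_eq0 x0 nsq_ge0.
rewrite vnorm2_sq -scalemxAr nsqZ exprVn sqr_sqrtr ?nsq_ge0 //.
by rewrite ler_pdivrMl // mulrC.
Qed.

Lemma specnorm_ge0 n (D : 'M[C]_n) : (0 < n)%N -> 0 <= specnorm D.
Proof.
move=> n0; have [K [K0 KP]] := nsq_mul_bounded D.
apply: le_trans (vnorm2_ge0 (D *m delta_mx (Ordinal n0) 0)) _.
apply: ub_le_sup; last by exists (delta_mx (Ordinal n0) 0) => //=; apply/vnorm2_eq1/delta_unit.
exists (Num.sqrt K) => _ [z z1 <-]; rewrite vnorm2E ler_sqrt //.
by rewrite (le_trans (KP _ _)) // -vnorm2_sq z1 expr1n mulr1.
Qed.

Lemma specnorm_le n (D : 'M[C]_n) c : (0 < n)%N -> 0 <= c ->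
  (forall x : 'cV[C]_n, nsq (D *m x) <= c ^+ 2 * nsq x) -> specnorm D <= c.
Proof.
move=> n0 c0 DP; apply: ge_sup.
  exists (vnorm2 (D *m delta_mx (Ordinal n0) 0)).
  by exists (delta_mx (Ordinal n0) 0) => //=; apply/vnorm2_eq1/delta_unit.
by move=> _ [z z1 <-]; have := vnorm2_le c0 (DP z); rewrite z1 mulr1.
Qed.

End SpectralNorm.

(** Because [0 < m], the constant [D] does not reach degree [m], and the determinant has the
    coefficient [\det (A ord_max)] in degree [n * m]. Nonvanishing lets [mup] be read as
    divisibility by powers of [X - mu]. *)
Lemma matpoly_det_neq0 (R : realType) n m (A : 'I_m.+1 -> 'M[R[i]]_n) (D : 'M[R[i]]_n) :
  (0 < m)%N -> \rank (A ord_max) = n -> \det (matpoly A + map_mx polyC D) != 0.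
Proof.
move=> m0 rkA; have Au : A ord_max \in unitmx by rewrite -row_full_unit /row_full rkA.
have entry a b : (matpoly A + map_mx polyC D) a b
    = \sum_(j < m.+1) A j a b *: 'X^j + (D a b)%:P.
  rewrite !mxE summxE; congr (_ + _); apply: eq_bigr => j _.
  by rewrite !mxE mulrC mul_polyC.
have sz a b : (size ((matpoly A + map_mx polyC D) a b)%R <= m.+1)%N.
  rewrite entry (leq_trans (size_polyD _ _)) // geq_max; apply/andP; split.
    apply: (leq_trans (size_sum _ _ _)); apply/bigmax_leqP => j _.
    by rewrite (leq_trans (size_scale_leq _ _)) // size_polyXn.
  by rewrite (leq_trans (size_polyC_leq1 _)).
have := coef_det_top sz.
have -> : map_mx (coefp m) (matpoly A + map_mx polyC D) = A ord_max.
  apply/matrixP => a b; rewrite mxE /= entry coefD coefC.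
  rewrite [X in (if X then _ else _)](_ : _ = false) ?addr0; last by case: (m) m0.
  rewrite coef_sum big_ord_recr /= big1 ?add0r => [|j _].
    by rewrite coefZ coefXn eqxx mulr1.
  by rewrite coefZ coefXn gtn_eqF ?mulr0.
move=> detE; apply: contraTneq Au => d0.
by rewrite unitmxE -detE d0 coef0 unitr0.
Qed.

Section LowerBound.
Variables (R : realType) (n r : nat) (mu : R[i]) (P : 'M[{poly R[i]}]_n).

(** [mxact_kernel] with [W] the identity gives a space of dimension at least [r.+1] on which [Q]
    acts as [X |-> - D X]. The spectral norm bounds this column by column, and [sigma_min_le]
    applies. *)
Lemma sigma_min_le_specnorm (G : 'M[R[i]]_r.+1) (D : 'M[R[i]]_n) :
  (0 < n)%N -> strict_lower G ->
  (r.+1 <= mup mu (\det (P + map_mx polyC D)))%N ->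
  \det (P + map_mx polyC D) != 0 ->
  sigma_min r.+1 (Qmx mu G P) <= specnorm D.
Proof.
move=> n0 Glow mupD det0.
pose Cm := mu%:M + G^T.
have CN : Cm - mu%:M = G^T by rewrite /Cm addrC addKr.
have nil : (Cm - mu%:M) ^+ r.+1 = 0.
  by rewrite CN -trmx_exp strict_lower_nilpotent // trmx0.
have [||S [dimS inS]] := @mxact_kernel _ n r Cm mu _ (P + map_mx polyC D) _ 1%:M nil.
- by rewrite stablemx_full // row_full_unit unitmx1.
- by rewrite mxrank1 -mup_geq.
apply: (@sigma_min_le _ _ _ _ _ S (@vec R n r.+1)).
- by rewrite /= sum_nat_const card_ord leq_pmulr.
- by rewrite mxrank1 in dimS.
- exact: vec_inj.
- exact: specnorm_ge0.
move=> X XS; rewrite /= Qmx_vec // !nsq_vec.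
have [_] := inS X XS; rewrite mxactDl mxact_const => /eqP; rewrite addr_eq0 => /eqP ->.
have -> : nsq (- (D *m X)) = nsq (D *m X).
  by rewrite !nsqE; do 2 (apply: eq_bigr => ? _); rewrite mxE normrN.
rewrite nsq_cols (nsq_cols X) mulr_sumr ler_sum // => j _.
by rewrite colE -mulmxA -colE specnorm_bound.
Qed.
End LowerBound.

(** * First-order optimality at a maximiser *)

Section Stationarity.
Variable R : realType.
Local Notation C := R[i].

Lemma rdot_scale2 m n (c : C) (X Y : 'M[C]_(m, n)) :
  rdot (c *: X) (c *: Y) = complex.Re `|c| ^+ 2 * rdot X Y.
Proof.
have -> : rdot (c *: X) (c *: Y) = rdot X (((complex.Re `|c| ^+ 2)%:C)%C *: Y).
  rewrite rdot.unlock -scalemxAr; congr (complex.Re (\tr _)).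
  have -> : (c *: X)^t* = c^* *: X^t* by apply/matrixP => i j; rewrite !mxE rmorphM.
  rewrite -scalemxAl scalerA -normCK -scalemxAr; congr (_ *: _).
  by rewrite normc_def -rmorphXn.
exact: rdotZr.
Qed.

Lemma unit_1D_small r (x : 'M[C]_r) (K t : R) :
  (forall n (Y : 'M[C]_(n, r)), nsq (Y *m x) <= K * nsq Y) -> t ^+ 2 * K < 1 ->
  1%:M + (t%:C)%C *: x \in unitmx.
Proof.
move=> KP tK; rewrite unitmxE unitfE; apply/negP => /det0P[y y0].
rewrite mulmxDr mulmx1 -scalemxAr => /eqP; rewrite addr_eq0 => /eqP yE.
have ny : 0 < nsq y by rewrite lt_def nsq_eq0 y0 nsq_ge0.
have : nsq y <= t ^+ 2 * K * nsq y.
  by rewrite {1}yE -scaleNr -rmorphN nsqZ sqrrN -mulrA ler_wpM2l ?sqr_ge0.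
by rewrite leNgt gtr_pMl // tK.
Qed.

Lemma vecB n r (c : C) (X Y : 'M[C]_(n, r)) : vec (X - c *: Y) = vec X - c *: vec Y.
Proof. by rewrite linearB linearZ. Qed.

Lemma sub_scale_delta N (w : 'cV[C]_N) c (i0 i : 'I_N) :
  (w - c *: delta_mx i0 0) i 0 = w i 0 - c * (i == i0)%:R.
Proof. by rewrite !mxE andbT. Qed.

Lemma dim_fullv_vec n r :
  \dim (fullv : {vspace 'M[C]_(n, r)}) = (\sum_(i < r) n)%N.
Proof. by rewrite dimvf /dim /= sum_nat_const card_ord mulnC. Qed.

(** In [stationary_gram], [a] and [b] are the dimensions of [S1] and [S2], and [j] counts the
    singular values below [s]. *)
Lemma constraint_count (a b j k N : nat) :
  (N <= a + j)%N -> (j < k)%N -> (a + k <= b + N)%N -> (0 < b)%N.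
Proof. lia. Qed.

(** Simplicity singles out the index [i0], and [v] is the matching eigenvector of [Q^t* *m Q]. No
    left vector appears, so that [s = 0] is covered, where [Q *m v] cannot be normalised. *)
Lemma singular_frame N (Q : 'M[C]_N) k (s := sigma_min k Q) :
  (0 < k <= N)%N -> count_mem s (singvals Q) = 1%N ->
  exists (W : 'M[C]_N) (sv : 'I_N -> R) (i0 : 'I_N) (v : 'cV[C]_N),
    [/\ W \is unitarymx /\ W *m (Q^t* *m Q) = diag_mx (\row_i ((sv i) ^+ 2)%:C%C) *m W,
        (forall i, 0 <= sv i) /\ (#|finset (fun i => sv i < s)%R| < k)%N,
        forall i, (sv i == s) = (i == i0),
        W *m v = delta_mx i0 0 /\ nsq v = 1
      & Q^t* *m (Q *m v) = ((s ^+ 2)%:C)%C *: v].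
Proof.
move=> kN mult; have [W [sv [Wu sv0 sE WA]]] := singvals_spectral Q.
have [cJ _] := card_singvals sE kN.
have [i0 i0P] : exists i0, forall i, (sv i == s) = (i == i0).
  have : #|finset (fun i => sv i == s)| == 1%N.
    rewrite cardE {1}/enum_mem -enumT size_filter.
    move: mult; rewrite sE (permP (permEl (perm_sort _ _))) count_map => {1}<-.
    by apply/eqP; apply: eq_count => i; rewrite /= inE.
  move=> /cards1P[i0 /setP E]; exists i0 => i.
  by have := E i; rewrite !inE.
have svi0 : sv i0 = s by apply/eqP; rewrite i0P.
pose v : 'cV[C]_N := W^t* *m delta_mx i0 0.
have Wv : W *m v = delta_mx i0 0.
  by rewrite mulmxA (unitarymxP Wu) mul1mx.
exists W, sv, i0, v; split=> //.
  by rewrite -(nsq_mul_unitary v Wu) Wv delta_unit.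
rewrite mulmxA -[Q^t* *m Q](mulKmx (unitarymx_unit Wu)) WA (invmx_unitary Wu).
rewrite -!mulmxA Wv /v scalemxAr; congr (_ *m _).
apply/colP => i; rewrite mul_diag_mx !mxE.
by case: eqVneq => [->|_]; rewrite ?svi0 ?mulr0.
Qed.

Lemma consistent_pair_pos N (Q : 'M[C]_N) (v : 'cV[C]_N) (s : R) :
  0 < s -> nsq v = 1 -> Q^t* *m (Q *m v) = ((s ^+ 2)%:C)%C *: v ->
  exists u, consistent_pair Q s u v.
Proof.
move=> s0 nv QQv; have s_neq0 : s != 0 by rewrite gt_eqF.
have scC (a b : R) m p (X : 'M[C]_(m, p)) :
    (a%:C)%C *: ((b%:C)%C *: X) = ((a * b)%:C)%C *: X by rewrite scalerA rmorphM.
exists ((s^-1)%:C%C *: (Q *m v)); split.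
- apply: vnorm2_eq1; rewrite nsqZ {1}/nsq rdot_mull QQv rdotZr -/(nsq v) nv mulr1.
  by rewrite exprVn mulVf // expf_neq0.
- exact: vnorm2_eq1.
- by rewrite scC mulfV //; apply/esym/scale1r.
rewrite ctrmx_real_scale -scalemxAl -[X in _ *: (_ *m X)]trmxCK.
rewrite -ctrmxM QQv ctrmx_real_scale scC.
by congr ((_%:C)%C *: _); rewrite expr2 mulKf.
Qed.

Lemma norm_mulr_real (a : C) (s : R) :
  0 <= s -> complex.Re `|a * (s%:C)%C| ^+ 2 = s ^+ 2 * complex.Re `|a| ^+ 2.
Proof.
move=> s0; rewrite normrM normc_def [`|(s%:C)%C|]ger0_norm ?ler0c //.
by rewrite -rmorphM /= exprMn mulrC.
Qed.

(** Pythagoras along [v]. In [nsq (Q *m x) - s ^+ 2 * nsq x] the coordinate [i0] cancels, those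
    below [s] are absent, and each other one contributes at least [gam] times its square. *)
Lemma frame_split N (Q W : 'M[C]_N) (sv : 'I_N -> R) i0 (v x : 'cV[C]_N) (s gam : R)
    (a := (W *m x) i0 0) (y := x - a *: v) :
  W \is unitarymx -> W *m (Q^t* *m Q) = diag_mx (\row_i ((sv i) ^+ 2)%:C%C) *m W ->
  (forall i, (sv i == s) = (i == i0)) -> W *m v = delta_mx i0 0 ->
  (forall i, s < sv i -> gam <= sv i ^+ 2 - s ^+ 2) ->
  (forall i, sv i < s -> (W *m x) i 0 = 0) ->
  nsq x = complex.Re `|a| ^+ 2 + nsq y /\ gam * nsq y <= nsq (Q *m x) - s ^+ 2 * nsq x.
Proof.
move=> Wu WA i0P Wv gamP x0.
have wy i : (W *m y) i 0 = if i == i0 then 0 else (W *m x) i 0.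
  rewrite mulmxBr -scalemxAr Wv sub_scale_delta.
  by case: eqVneq => [->|_]; rewrite ?mulr1 ?subrr // mulr0 subr0.
have nrow (w : 'cV[C]_N) i : nsq (row i w) = complex.Re `|w i 0| ^+ 2.
  by rewrite nsqE !big_ord1 mxE.
have n0 : complex.Re `|0 : C| ^+ 2 = 0 by rewrite normr0 expr0n.
clearbody y; split.
  rewrite (nsq_unitary_rows Wu x) (nsq_unitary_rows Wu y) (bigD1 i0) //.
  rewrite [X in _ = _ + X](bigD1 i0) // nrow; congr (_ + _).
  rewrite nrow wy eqxx n0 [RHS]add0r; apply: eq_bigr => i /negPf ii.
  by rewrite !nrow wy ii.
rewrite (nsq_spectral Wu WA) (nsq_unitary_rows Wu x) (nsq_unitary_rows Wu y).
rewrite !mulr_sumr -sumrB; apply: ler_sum => i _; rewrite -mulrBl !nrow wy.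
have [->|ii] := eqVneq i i0; first by rewrite n0 mulr0 (eqP (etrans (i0P i0) (eqxx _))) subrr mul0r.
have [lt|gt|eq] := ltgtP (sv i) s.
- by rewrite x0 // n0 !mulr0.
- by rewrite ler_wpM2r ?sqr_ge0 ?gamP.
- by case/negP: ii; rewrite -i0P eq.
Qed.

(** Arithmetic of [stationary_gram]: [al] and [et] are the squared norms along the singular vector
    and off it. The spectral gap and the two first-order estimates add up to the positive expression
    of [perturb_scalar]. *)
Lemma perturb_combine (K L s d g e t al et rUU rVV rYY rZZ nY nZ nz nYg nZg : R) :
  0 <= K -> 0 < e -> 0 < t ->
  0 < g * et
      + t * (2 * al * s ^+ 2 * d
             - (1 + K) * (e * (s ^+ 2 * al) + (e^-1 + 1) * (L * et))
             - s ^+ 2 * ((1 + K) * (e * al + (e^-1 + 1) * et)))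
      - s ^+ 2 * (t ^+ 2 * (K * (al + et))) ->
  d = rUU - rVV -> nY = al + et -> nz <= L * et ->
  g * et <= nZ - s ^+ 2 * nY ->
  `|2 * rYY - 2 * (al * rVV)| <= (1 + K) * (e * al + (e^-1 + 1) * et) ->
  `|2 * rZZ - 2 * (s ^+ 2 * al * rUU)| <= (1 + K) * (e * (s ^+ 2 * al) + (e^-1 + 1) * nz) ->
  nYg <= nY + t * (2 * rYY) + t ^+ 2 * (K * nY) ->
  nZ + t * (2 * rZZ) <= nZg ->
  s ^+ 2 * nYg < nZg.
Proof.
move=> K0 e0 t0 pos dE nYE nzL gap; rewrite !ler_norml => /andP[_ hY] /andP[hZ _] hYg hZg.
have s2 : 0 <= s ^+ 2 by apply: sqr_ge0.
have ei : 0 <= e^-1 + 1 by rewrite addr_ge0 // invr_ge0 ltW.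
have K1 : 0 <= 1 + K by rewrite addr_ge0.
have k0 := ler_wpM2l K1 (ler_wpM2l ei nzL).
have k3 := ler_wpM2l s2 hYg.
have k1 : t * (2 * s ^+ 2 * al * rUU
    - (1 + K) * (e * (s ^+ 2 * al) + (e^-1 + 1) * (L * et))) <= t * (2 * rZZ).
  by apply: (ler_wpM2l (ltW t0)); move: hZ k0; rewrite !mulrDr; lra.
have k2 : s ^+ 2 * (t * (2 * rYY)) <= s ^+ 2 * (t * (2 * al * rVV
    + (1 + K) * (e * al + (e^-1 + 1) * et))).
  by apply: (ler_wpM2l s2); apply: (ler_wpM2l (ltW t0)); move: hY; rewrite !mulrDr; lra.
apply: (le_lt_trans k3); apply: lt_le_trans hZg.
rewrite -subr_gt0; apply: (lt_le_trans pos); rewrite dE -subr_ge0.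
rewrite -subr_ge0 in k1; rewrite -subr_ge0 in k2; rewrite -subr_ge0 in gap.
have := addr_ge0 (addr_ge0 k1 k2) gap.
congr (0 <= _); rewrite nYE; move: (e^-1) => ei'; ring.
Qed.

(* First-order optimality: the singular vectors at a maximiser have equal Gram
   matrices.  Only the directions tangent to the conjugation orbit of [Gstar]
   are needed; along [G' = g^T Gstar g^-T] one has
   [Q(G') vec(Y g) = vec(Z g)] whenever [Q(Gstar) vec Y = vec Z]. *)
Lemma stationary_gram n r (mu : C) (P : 'M[{poly C}]_n) (G : 'M[C]_r.+1)
    (s := sigma_min r.+1 (Qmx mu G P)) :
  (0 < n)%N -> strict_lower G -> multiplicity_assumption mu P G -> 0 < s ->
  (forall G' : 'M[C]_r.+1, strict_lower G' -> sigma_min r.+1 (Qmx mu G' P) <= s) ->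
  exists U V : 'M[C]_(n, r.+1),
    consistent_pair (Qmx mu G P) s (vec U) (vec V) /\ U^t* *m U = V^t* *m V.
Proof.
move=> n0 Glow mult s0 smax; pose Q := Qmx mu G P.
have N_r : (0 < r.+1 <= \sum_(i < r.+1) n)%N.
  by rewrite /= sum_nat_const card_ord leq_pmulr.
have [W [sv [i0 [v0 [[Wu WA] [sv0 cJ] i0P [Wv0 nv0] QQv0]]]]] := singular_frame N_r mult.
have svi0 : sv i0 = s by apply/eqP; rewrite i0P.
have [u0 pair0] := consistent_pair_pos s0 nv0 QQv0.
have [V vV] := vec_surj v0; have [U uU] := vec_surj u0.
exists U, V; split; first by rewrite -vV -uU.
have [/(congr1 (fun z => z ^+ 2)) nu0 _ Qv0 _] := pair0.
rewrite vnorm2_sq expr1n in nu0.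
have nU : nsq U = 1 by rewrite -nsq_vec -uU.
have nV : nsq V = 1 by rewrite -nsq_vec -vV.
apply/eqP; rewrite -subr_eq0; apply/negPn/negP => E0.
have [|x [xtri xpos]] := upper_tri_selector _ E0.
  by rewrite ctrmxB !ctrmxM !trmxCK.
(* Half the derivative at [t = 0] of [nsq (U *m g) - nsq (V *m g)] for [g = 1 + t x]. *)
pose d := rdot U (U *m x) - rdot V (V *m x).
have d0 : 0 < d.
  move: xpos; rewrite mulmxBl [\tr _]linearB /= /d rdot.unlock.
  by rewrite (mulmxA (U^t*)) (mulmxA (V^t*)) (raddfB (@complex.Re R)).
have [K [K0 KP]] := nsq_mulr_bounded x.
have [L [L0 LP]] := nsq_mul_bounded Q.
have [gam gam0 gamP] : exists2 g, 0 < g &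
    forall i, s < sv i -> g <= sv i ^+ 2 - s ^+ 2.
  apply: finite_gap => i si; rewrite subr_gt0.
  by rewrite ltr_pXn2r // nnegrE ?sv0 // ltW.
have [e [t [e0 t0 tK pos]]] := perturb_scalar K0 L0 s0 d0 gam0.
set g := 1%:M + (t%:C)%C *: x; have gu : g \in unitmx := unit_1D_small KP tK.
(* Conjugation by the lower triangular [g^T] stays among strictly lower triangular matrices and
   conjugates [mu + G^T] by [g]. *)
pose G' := g^T *m G *m invmx g^T.
have gTu : g^T \in unitmx by rewrite unitmx_tr.
have G'low : strict_lower G'.
  apply: (strict_lower_conj _ gTu Glow); last by rewrite /G' mulmxKV.
  move=> i j ij; rewrite !mxE xtri // mulr0 addr0.
  by case: eqVneq => // ji; rewrite ji ltnn in ij.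
have G'T : mu%:M + G'^T = invmx g *m (mu%:M + G^T) *m g.
  rewrite (mulmxDr (invmx g)) mulmxDl mul_mx_scalar -scalemxAl mulVmx // scalemx1.
  by rewrite /G' !trmx_mul trmx_inv trmxK mulmxA.
(* [S1] avoids the components at singular values below [s]; [S2] is the part of it where [Q] at [G']
   expands by at most its own singular value. *)
have [S1 [_ dS1 fS1]] := exists_constrained fullv (mulmx W \o @vec R n r.+1)
  (finset (fun i => sv i < s)).
have [S2 [S21 dS2 fS2]] := sigma_min_upper (Qmx mu G' P) S1
  (@vec R n r.+1 \o mulmxr g) N_r.
have S20 : S2 != 0%VS.
  rewrite -dimv_eq0 -lt0n; rewrite dim_fullv_vec in dS1.
  exact: constraint_count dS1 cJ dS2.
have YS2 := memv_pick S2; set Y := vpick S2 in YS2.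
have Y0 : Y != 0 by rewrite vpick0.
set Z := mxact (mu%:M + G^T) P Y.
have QY : Q *m vec Y = vec Z by apply: Qmx_vec.
(* Maximality of [s] enters here. *)
have upper : nsq (Z *m g) <= s ^+ 2 * nsq (Y *m g).
  have := fS2 Y YS2; rewrite /= Qmx_vec // G'T mxact_conj // !nsq_vec -/Z => h.
  have hs : sigma_min r.+1 (Qmx mu G' P) ^+ 2 <= s ^+ 2.
    by apply: lerXn2r; rewrite ?nnegrE; [apply: sigma_min_ge0|apply: ltW|apply: smax].
  exact: le_trans h (ler_wpM2r (nsq_ge0 _) hs).
have wY0 i : sv i < s -> (W *m vec Y) i 0 = 0.
  by move=> si; apply: (fS1 Y (subvP S21 _ YS2)); rewrite inE.
(* [V] and [U] carry the components at [s]; as [Q] sends [vec V] to [s vec U], it sends [vec y] to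
   [vec z]. *)
pose a := (W *m vec Y) i0 0; pose y := Y - a *: V; pose z := Z - (a * (s%:C)%C) *: U.
have vecy : vec y = vec Y - a *: v0 by rewrite vecB -vV.
have [nY gap] := frame_split Wu WA i0P Wv0 gamP wY0.
rewrite -/a -vecy !nsq_vec QY nsq_vec in nY gap.
have Qy : Q *m vec y = vec z.
  rewrite vecy /z vecB -uU mulmxBr QY -scalemxAr Qv0.
  by rewrite scalerA.
have nz : nsq z <= L * nsq y by rewrite -nsq_vec -Qy -(nsq_vec y).
pose al := complex.Re `|a| ^+ 2; rewrite -/al in nY.
have al0 : 0 <= al by apply: sqr_ge0.
have ae : 0 < al + nsq y by rewrite -nY lt_def nsq_eq0 Y0 nsq_ge0.
have YE : Y = a *: V + y by rewrite /y addrC subrK.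
have ZE : Z = (a * (s%:C)%C) *: U + z by rewrite /z addrC subrK.
have pY := rdot_mulr_perturb (a *: V) y (KP n) e0.
have pZ := rdot_mulr_perturb ((a * (s%:C)%C) *: U) z (KP n) e0.
rewrite -YE -scalemxAl /nsq !rdot_scale2 -/(nsq V) nV mulr1 -/al -/(nsq y) in pY.
rewrite -ZE -scalemxAl /nsq !rdot_scale2 norm_mulr_real ?(ltW s0) // in pZ.
rewrite -/(nsq U) nU mulr1 -/al -/(nsq z) in pZ.
have nYg : nsq (Y *m g) <= nsq Y + t * (2 * rdot Y (Y *m x)) + t ^+ 2 * (K * nsq Y).
  rewrite mulmxDr mulmx1 -scalemxAr nsqD nsqZ rdotZr.
  by rewrite [2 * (t * _)]mulrCA lerD2l ler_wpM2l ?sqr_ge0.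
have nZg : nsq Z + t * (2 * rdot Z (Z *m x)) <= nsq (Z *m g).
  rewrite mulmxDr mulmx1 -scalemxAr nsqD nsqZ rdotZr.
  by rewrite [2 * (t * _)]mulrCA lerDl mulr_ge0 ?sqr_ge0 ?nsq_ge0.
(* The estimates force [nsq (Z *m g)] above [s ^+ 2 * nsq (Y *m g)], against [upper]. *)
have := perturb_combine K0 e0 t0 (pos _ _ al0 (nsq_ge0 y) ae) erefl nY nz gap pY pZ nYg nZg.
by rewrite ltNge upper.
Qed.
End Stationarity.

(** * The attaining perturbation *)

Section UpperBound.
Variable R : realType.
Local Notation C := R[i].

(** A singular square matrix also has a left kernel vector. Any such [u] makes the linear
    independence assumption applicable to [v]. *)
Lemma consistent_pair_zero N (Q : 'M[C]_N) (v : 'cV[C]_N) :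
  nsq v = 1 -> Q *m v = 0 -> exists u, consistent_pair Q 0 u v.
Proof.
move=> nv Qv; have v0 : v != 0 by rewrite -nsq_eq0 nv oner_eq0.
have [y y0 yQ] : exists2 y : 'rV_N, y != 0 & y *m Q = 0.
  apply/det0P; rewrite -det_tr; apply/det0P; exists v^T; first by rewrite trmx_eq0.
  by rewrite -trmx_mul Qv trmx0.
have y0' : y^t* != 0 by rewrite -nsq_eq0 nsq_ctr nsq_eq0.
exists (((Num.sqrt (nsq (y^t*)))^-1)%:C%C *: y^t*); split.
- exact/vnorm2_eq1/nsq_normalize.
- exact: vnorm2_eq1.
- by rewrite Qv scale0r.
by rewrite ctrmx_real_scale trmxCK -scalemxAl yQ scaler0 scale0r.
Qed.

(** [D = - s U L] with [L] the pseudo-inverse of [V]. Equal Gram matrices give [U L x] the norm of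
    [V L x], the orthogonal projection of [x] onto the range of [V]. *)
Lemma gram_eq_extension n r (U V : 'M[C]_(n, r)) (s : R) :
  U^t* *m U = V^t* *m V -> \rank V = r ->
  exists D : 'M[C]_n, D *m V = - ((s%:C)%C *: U)
    /\ forall x : 'cV[C]_n, nsq (D *m x) <= s ^+ 2 * nsq x.
Proof.
move=> gram rkV; have /row_fullP[L0 L0V] : row_full V by rewrite /row_full rkV.
have Mu : V^t* *m V \in unitmx.
  rewrite unitmxE unitfE; apply/negP => /det0P[z z0 zM].
  have Mz : V^t* *m (V *m z^t*) = 0.
    have -> : V^t* *m (V *m z^t*) = (z *m (V^t* *m V))^t* by rewrite !ctrmxM trmxCK mulmxA.
    by rewrite zM trmx0 map_mx0.
  have Vz : V *m z^t* = 0 by apply/eqP; rewrite -nsq_eq0 /nsq rdot_mull Mz rdotr0.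
  case/negP: z0; rewrite -nsq_eq0 -nsq_ctr nsq_eq0 -[z^t*]mul1mx -L0V -mulmxA Vz.
  by rewrite mulmx0.
pose L := invmx (V^t* *m V) *m V^t*.
have LV : L *m V = 1%:M by rewrite -mulmxA mulVmx.
exists (- ((s%:C)%C *: (U *m L))); split=> [|x].
  by rewrite mulNmx -scalemxAl -mulmxA LV mulmx1.
have -> : nsq (- ((s%:C)%C *: (U *m L)) *m x) = s ^+ 2 * nsq (V *m (L *m x)).
  rewrite -scaleNr -rmorphN -scalemxAl nsqZ sqrrN -mulmxA; congr (_ * _).
  by rewrite /nsq [LHS]rdot_mull [RHS]rdot_mull (mulmxA (U^t*)) gram -mulmxA.
rewrite ler_wpM2l ?sqr_ge0 //; set p := V *m _.
have px : rdot p (x - p) = 0.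
  rewrite /p rdot_mull mulmxBr !mulmxA mulmxV // mul1mx subrr.
  exact: rdotr0.
have -> : nsq x = nsq (p + (x - p)) by rewrite addrC subrK.
by rewrite nsqD px mulr0 addr0 lerDl nsq_ge0.
Qed.

Lemma char_poly_strict_lower r (G : 'M[C]_r.+1) mu :
  strict_lower G -> char_poly (mu%:M + G^T) = ('X - mu%:P) ^+ r.+1.
Proof.
move=> Glow; have -> : char_poly (mu%:M + G^T) = char_poly (mu%:M + G).
  rewrite /char_poly -det_tr; congr (\det _); apply/matrixP => i j.
  by rewrite !mxE (eq_sym j).
rewrite char_poly_trig.
  under eq_bigr do rewrite !mxE eqxx Glow // addr0.
  by rewrite prodr_const card_ord.
apply/is_trig_mxP => i j ij; rewrite !mxE Glow ?(ltnW ij) // addr0.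
by case: eqVneq => // eq_ij; rewrite eq_ij ltnn in ij.
Qed.

Lemma mup_ge_of_eigenblock n r mu (P : 'M[{poly C}]_n) (G : 'M[C]_r.+1)
    (V : 'M[C]_(n, r.+1)) :
  strict_lower G -> \rank V = r.+1 -> mxact (mu%:M + G^T) P V = 0 ->
  \det P != 0 -> (r.+1 <= mup mu (\det P))%N.
Proof.
move=> Glow rkV PV det0; have /row_fullP[L LV] : row_full V by rewrite /row_full rkV.
by rewrite mup_geq // -(char_poly_strict_lower mu Glow); apply: char_poly_dvd_det LV PV.
Qed.

(** If [s > 0], stationarity supplies the equal Gram matrices for [gram_eq_extension]. If [s = 0],
    the right singular vector lies in the kernel of [Q] and [D = 0] works. *)
Lemma attaining_perturbation n r mu (P : 'M[{poly C}]_n) (G : 'M[C]_r.+1)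
    (s := sigma_min r.+1 (Qmx mu G P)) :
  (0 < n)%N -> strict_lower G -> multiplicity_assumption mu P G ->
  linear_independence_assumption mu P G ->
  (forall G' : 'M[C]_r.+1, strict_lower G' -> sigma_min r.+1 (Qmx mu G' P) <= s) ->
  (forall D : 'M[C]_n, \det (P + map_mx polyC D) != 0) ->
  exists D : 'M[C]_n, (r.+1 <= mup mu (\det (P + map_mx polyC D)))%N
    /\ specnorm D <= s.
Proof.
move=> n0 Glow mult indep smax det0.
have s0 : 0 <= s := sigma_min_ge0 _ _.
have [s_gt0|s_le0] := ltP 0 s.
  have [U [V [UV gram]]] := stationary_gram n0 Glow mult s_gt0 smax.
  have rkV := indep _ _ V UV erefl.
  have [D [DV Dle]] := gram_eq_extension s gram rkV.
  exists D; split; last exact: specnorm_le.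
  apply: (mup_ge_of_eigenblock Glow rkV) => //.
  rewrite mxactDl mxact_const DV; apply/eqP; rewrite subr_eq0; apply/eqP.
  apply: vec_inj; rewrite -Qmx_vec //; have [_ _ -> _] := UV.
  exact/esym/linearZ.
have sE : s = 0 by apply/eqP; rewrite eq_le s_le0.
have N_r : (0 < r.+1 <= \sum_(i < r.+1) n)%N.
  by rewrite /= sum_nat_const card_ord leq_pmulr.
have [W [sv [i0 [v [_ _ _ [_ nv] QQv]]]]] := singular_frame N_r mult.
have Qv : Qmx mu G P *m v = 0.
  by apply/eqP; rewrite -nsq_eq0 /nsq rdot_mull QQv -/s sE expr0n scale0r rdotr0.
have [u uv] := consistent_pair_zero nv Qv.
have [V vV] := vec_surj v.
have rkV : \rank V = r.+1.
  by apply: (indep u v V _ vV); rewrite -/s sE.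
exists 0; rewrite map_mx0 addr0; split; last first.
  apply: specnorm_le => // x; rewrite mul0mx nsq0.
  by rewrite mulr_ge0 ?sqr_ge0 ?nsq_ge0.
apply: (mup_ge_of_eigenblock Glow rkV); last first.
  by have := det0 0; rewrite map_mx0 addr0.
by apply: vec_inj; rewrite -Qmx_vec // -vV Qv linear0.
Qed.
End UpperBound.

(** * Equality of the distance and the supremum *)

Theorem corollary3p4 (R : realType) (n m r : nat)
    (A : 'I_m.+1 -> 'M[R[i]]_n) (mu : R[i]) (Gstar : 'M[R[i]]_r)
    (n_gt0 : (0 < n)%N) (m_gt0 : (0 < m)%N) (r_gt0 : (0 < r)%N)
    (rank_lead : \rank (A ord_max) = n)
    (Gstar_param : strict_lower Gstar)
    (Gstar_attains :
      (sigma_min r (Qmx mu Gstar (matpoly A)))%:E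
      = ereal_sup [set (sigma_min r (Qmx mu G (matpoly A)))%:E
                  | G in @strict_lower R r])
    (Gstar_mult : multiplicity_assumption mu (matpoly A) Gstar)
    (Gstar_indep : linear_independence_assumption mu (matpoly A) Gstar) :
  eig_dist (matpoly A) r mu
  = ereal_sup [set (sigma_min r (Qmx mu G (matpoly A)))%:E
              | G in @strict_lower R r].
Proof.
case: r r_gt0 Gstar Gstar_param Gstar_attains Gstar_mult Gstar_indep => // r _.
move=> Gstar Glow attains mult indep.
have det0 D : \det (matpoly A + map_mx polyC D) != 0 := matpoly_det_neq0 D m_gt0 rank_lead.
have smax (G : 'M[R[i]]_r.+1) : strict_lower G ->
    sigma_min r.+1 (Qmx mu G (matpoly A)) <= sigma_min r.+1 (Qmx mu Gstar (matpoly A)).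
  by move=> G_low; rewrite -lee_fin [leRHS]attains; apply: ereal_sup_ubound; exists G.
rewrite -attains; apply/le_anti/andP; split.
  have [D [mupD normD]] := attaining_perturbation n_gt0 Glow mult indep smax det0.
  apply: (@le_trans _ _ (specnorm D)%:E); last by rewrite lee_fin.
  by apply: ereal_inf_lbound; exists D.
apply: le_ereal_inf_tmp => _ [D mupD <-]; rewrite lee_fin.
exact: sigma_min_le_specnorm n_gt0 Glow mupD (det0 D).
Qed.
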